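(* If $x\in\mathbb{R}^n$ is a point where $\psi$ is twice differentiable, then the transport maps $T_\tau$ are differentiable at $x$ for every $\tau\in[0,T]$, and, for every $s\in(0,T]$, it holds \begin{equation} \det(\nabla T_\tau(x))^{1/n}\geq\frac{\det(R_3(\tau-s))^{1/n}}{\det(R_3(-s))^{1/n}}+\frac{\det(R_3(\tau))^{1/n}}{\det(R_3(s))^{1/n}}\det(\nabla T_s(x))^{1/n},\qquad\forall \tau\in[0,s]. \end{equation} Moreover, both terms in the right hand side are non-negative for $\tau\in[0,s]$ and, for $\tau\in[0,s)$, the first one is positive. In particular, $\det(\nabla T_\tau(x))>0$ for all $\tau\in[0,T)$.
   Context: Let $n,m\in\mathbb{N}$, $m\leq n$, $A\in\mathbb{R}^{n\times n}$, $B\in\mathbb{R}^{n\times m}$ of rank $m$, $Q\in\mathbb{R}^{n\times n}$ symmetric, and let $(A,B,Q,T)$ be the LQ optimal control problem for $\dot x=Ax+Bu$ with cost $c=c^{0,T}$ given by the infimum of $\frac12\int_0^T(|u|^2-x^*Qx)\,d\tau$, satisfying the Kalman condition, with $T<t^*$ ($t^*$ the first conjugate time). Let $\Omega=\begin{pmatrix}\mathbb{0}_n & \mathbb{1}_n\\ -\mathbb{1}_n & \mathbb{0}_n\end{pmatrix}$, $H=\begin{pmatrix}BB^* & A\\ A^* & Q\end{pmatrix}$ and $e^{-\tau\Omega H}=\begin{pmatrix}R_1(\tau) & R_2(\tau)\\ R_3(\tau) & R_4(\tau)\end{pmatrix}$; the LQ exponential map is $\exp_{x,\tau}(p)=R_3(\tau)p+R_4(\tau)x$.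 Consider $\mu,\nu\in P_2(\mathbb{R}^n)$ with $\mu\ll\mathscr{L}^n$, and a ($c$-convex) Kantorovich potential $\psi$ for the LQ transport problem from $\mu$ to $\nu$. For $\tau\in[0,T]$, let $T_\tau(x)=\exp_{x,\tau}(\nabla\psi(x))$ be the optimal transport map from $\mu$ to the displacement interpolation $\mu_\tau$ for the cost $c^{0,\tau}$. *)

(* Defs.v *)
From HB Require Import structures.
From mathcomp Require Import all_boot all_order all_algebra.
From mathcomp Require Import all_classical all_reals all_analysis.

Set Implicit Arguments.
Unset Strict Implicit.
Unset Printing Implicit Defensive.

Import Order.TTheory GRing.Theory Num.Theory.
Import numFieldNormedType.Exports.

Local Open Scope classical_set_scope.
Local Open Scope ring_scope.

Section LQ.
Variable R : realType.

Definition enorm k (v : 'cV[R]_k) : R := Num.sqrt (\sum_i (v i 0) ^+ 2).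

Definition dotv k (u v : 'cV[R]_k) : R := (u^T *m v) 0 0.

Definition mexp k (M : 'M[R]_k) : 'M[R]_k :=
  lim (series (fun j : nat => (j`!%:R)^-1 *: (M ^+ j)) @ \oo).

Definition rootn (n : nat) (a : R) : R :=
  Num.sg a * (`|a| `^ (n%:R^-1)).

Definition Omega n : 'M[R]_(n + n) :=
  block_mx 0 1%:M (- 1%:M) 0.

Definition Hmat n m (A : 'M[R]_n) (B : 'M[R]_(n, m)) (Q : 'M[R]_n)
  : 'M[R]_(n + n) := block_mx (B *m B^T) A A^T Q.

Definition flow n m (A : 'M[R]_n) (B : 'M[R]_(n, m)) (Q : 'M[R]_n) (tau : R)
  : 'M[R]_(n + n) := mexp ((- tau) *: (Omega n *m Hmat A B Q)).

Definition R3 n m A B Q tau : 'M[R]_n := dlsubmx (@flow n m A B Q tau).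
Definition R4 n m A B Q tau : 'M[R]_n := drsubmx (@flow n m A B Q tau).

Definition lq_exp n m A B Q (x : 'cV[R]_n) (tau : R) (p : 'cV[R]_n)
  : 'cV[R]_n := R3 A B Q tau *m p + @R4 n m A B Q tau *m x.

Definition kalman n m (A : 'M[R]_n) (B : 'M[R]_(n, m)) : Prop :=
  \rank (\mxrow_(k < n) (A ^+ k *m B)) = n.

Definition first_conj_time n m A B Q : \bar R :=
  ereal_inf [set t%:E | t in [set t : R | 0 < t /\ \det (@R3 n m A B Q t) = 0]].

Definition admissible m (T : R) (u : R -> 'cV[R]_m) : Prop :=
  forall i : 'I_m,
    measurable_fun `[0, T] (fun s => u s i 0) /\
    (lebesgue_measure : measure _ R).-integrable `[0, T]
       (fun s => ((u s i 0) ^+ 2)%:E).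

(* the trajectory of xdot = A x + B u, x(0) = x0 (variation of constants) *)
Definition traj n m (A : 'M[R]_n) (B : 'M[R]_(n, m)) (x0 : 'cV[R]_n)
  (u : R -> 'cV[R]_m) (t : R) : 'cV[R]_n :=
  mexp (t *: A) *m x0 +
  \col_i Rintegral (lebesgue_measure : measure _ R) `[0, t]
     (fun s => (mexp ((t - s) *: A) *m B *m u s) i 0).

Definition lq_action n m A B (Q : 'M[R]_n) (T : R) (x0 : 'cV[R]_n)
  (u : R -> 'cV[R]_m) : R :=
  2^-1 * Rintegral (lebesgue_measure : measure _ R) `[0, T]
     (fun s => enorm (u s) ^+ 2
               - dotv (@traj n m A B x0 u s) (Q *m @traj n m A B x0 u s)).

Definition lq_cost n m A B Q (T : R) (x y : 'cV[R]_n) : \bar R :=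
  ereal_inf [set (@lq_action n m A B Q T x u)%:E | u in
    [set u | admissible T u /\ traj A B x u T = y]].

Definition Rn n := g_sigma_algebraType (@open 'cV[R]_n).
HB.instance Definition _ n := Measurable.on (Rn n).

Definition box n (a b : 'cV[R]_n) : set 'cV[R]_n :=
  [set z | forall i, a i 0 <= z i 0 <= b i 0].
Definition box_vol n (a b : 'cV[R]_n) : R :=
  \prod_i Num.max 0 (b i 0 - a i 0).
Definition leb_null n (N : set 'cV[R]_n) : Prop :=
  forall eps : R, 0 < eps -> exists a b : nat -> 'cV[R]_n,
    N `<=` \bigcup_k box (a k) (b k) /\
    (\sum_(k <oo) (box_vol (a k) (b k))%:E < eps%:E)%E.

Definition abs_cont_leb n (mu : probability (Rn n) R) : Prop :=
  forall N : set (Rn n), measurable N -> leb_null N -> mu N = 0%E.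

Definition finite_second_moment n (mu : probability (Rn n) R) : Prop :=
  (\int[mu]_x ((enorm (x : 'cV[R]_n)) ^+ 2)%:E < +oo)%E.

Definition coupling n (mu nu : probability (Rn n) R)
  (g : probability (Rn n * Rn n)%type R) : Prop :=
  (forall A : set (Rn n), measurable A -> g (A `*` setT) = mu A) /\
  (forall A : set (Rn n), measurable A -> g (setT `*` A) = nu A).

Definition transport_cost n (c : 'cV[R]_n -> 'cV[R]_n -> \bar R)
  (g : probability (Rn n * Rn n)%type R) : \bar R :=
  (\int[g]_z c z.1 z.2)%E.

Definition optimal_plan n c (mu nu : probability (Rn n) R)
  (g : probability (Rn n * Rn n)%type R) : Prop :=
  coupling mu nu g /\
  forall g', coupling mu nu g' -> (transport_cost c g <= transport_cost c g')%E.

(* c-convexity (Villani's convention):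
   psi(x) = sup_y (zeta(y) - c(x,y)) for some zeta, psi not identically +oo *)
Definition c_convex n (c : 'cV[R]_n -> 'cV[R]_n -> \bar R)
  (psi : 'cV[R]_n -> \bar R) : Prop :=
  (exists x, psi x != +oo%E) /\
  exists zeta : 'cV[R]_n -> \bar R,
    forall x, psi x = ereal_sup [set (zeta y - c x y)%E | y in setT].

Definition c_transform n (c : 'cV[R]_n -> 'cV[R]_n -> \bar R)
  (psi : 'cV[R]_n -> \bar R) (y : 'cV[R]_n) : \bar R :=
  ereal_inf [set (psi x + c x y)%E | x in setT].

Definition c_subdiff n c (psi : 'cV[R]_n -> \bar R) : set (Rn n * Rn n) :=
  [set z | psi z.1 \is a fin_num /\
           c_transform c psi z.2 = (psi z.1 + c z.1 z.2)%E].

Definition kantorovich_potential n c (mu nu : probability (Rn n) R)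
  (psi : 'cV[R]_n -> \bar R) : Prop :=
  c_convex c psi /\
  exists g, optimal_plan c mu nu g /\
    exists S, measurable S /\ S `<=` c_subdiff c psi /\ g S = 1%E.

Definition has_grad n (psi : 'cV[R]_n -> \bar R) (x g : 'cV[R]_n) : Prop :=
  psi x \is a fin_num /\
  forall eps : R, 0 < eps -> exists2 d : R, 0 < d & forall v : 'cV[R]_n,
    enorm v < d ->
    psi (x + v) \is a fin_num /\
    `| fine (psi (x + v)) - fine (psi x) - dotv g v | <= eps * enorm v.

Definition twice_diff n (psi : 'cV[R]_n -> \bar R) (x : 'cV[R]_n) : Prop :=
  exists (g : 'cV[R]_n) (H : 'M[R]_n),
    has_grad psi x g /\ H^T = H /\
    forall eps : R, 0 < eps -> exists2 d : R, 0 < d & forall v : 'cV[R]_n,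
      enorm v < d ->
      psi (x + v) \is a fin_num /\
      `| fine (psi (x + v)) - fine (psi x) - dotv g v - 2^-1 * dotv (H *m v) v |
        <= eps * enorm v ^+ 2.

(* the map y |-> Tmap(y) := exp_{y,tau}(grad psi(y)), defined where psi is
   differentiable, is differentiable at x with differential L *)
Definition transport_diff_at n m A B Q (psi : 'cV[R]_n -> \bar R) (tau : R)
  (x : 'cV[R]_n) (L : 'M[R]_n) : Prop :=
  forall gx, has_grad psi x gx ->
  forall eps : R, 0 < eps -> exists2 d : R, 0 < d & forall y gy,
    has_grad psi y gy -> enorm (y - x) < d ->
    enorm (@lq_exp n m A B Q y tau gy - @lq_exp n m A B Q x tau gx
           - L *m (y - x)) <= eps * enorm (y - x).

End LQ.

(* Main.v *)
Require Import Defs.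
From HB Require Import structures.
From mathcomp Require Import all_boot all_order all_algebra perm.
From mathcomp Require Import all_classical all_reals all_analysis measurable_realfun.
From mathcomp Require Import ring lra.
Set Implicit Arguments.
Unset Strict Implicit.

Import Order.TTheory GRing.Theory Num.Theory.
Import numFieldNormedType.Exports.
Local Open Scope classical_set_scope.
Local Open Scope ring_scope.

(** Let [K t = R3(t)^-1 R4(t)], so that the extremal steering [d] to [0] in time
    [t] has cost [d . K t d / 2]. Correcting an arbitrary control by a multiple
    of this extremal, and using that the action is quadratic, c-convexity gives
    that [psi + z . K T z / 2] is convex wherever [psi] is finite. Hence the
    gradient of [psi] is differentiable at [x], with differential the Hessian
    [P], and [P + K T >= 0]; moreover [psi] is differentiable on a dense set
    near [x], which makes the differential of the transport map unique, equal to
    [R3 t P + R4 t = R3 t (P + K t)].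

    Along the Hamiltonian flow [K' = - R3^-1 B B^* R3^-*], so [K] is
    nonincreasing, and the group law gives
    [K t - K s = R3(t)^-1 R3(t - s) R3(-s)^-1]. The inequality is then
    Minkowski's determinant inequality for the sum of positive semidefinite
    matrices [P + K t = (K t - K s) + (P + K s)]. *)

(** Three points shape the argument. First, semiconvexity with some constant would already give
    differentiability of the gradient, but the inequality up to [s = T] needs the sharp matrix
    [K T]: it is what makes [P + K s] positive semidefinite on all of [(0, T]]. The comparison is
    made for one target [y] and one control at a time, so minimizers are never invoked. Second,
    [transport_diff_at] tests only points where [psi] has a gradient. Uniqueness of the differential
    thus requires such points near [x + s *: e], for every direction [e], with an error small
    relative to [s]. They are produced as maximum points of [psi] minus a steep paraboloid, which
    replaces an almost-everywhere theorem. Third, [T] below the first conjugate time only says that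
    [det R3] has no zero on [(0, T]]; its sign has to be found. Since [K t - K T] is nonsingular,
    [P + K t] is definite for [t < T] even if [P + K T] is singular. Hence [det (R3 t P + R4 t)],
    continuous and equal to 1 at 0, stays positive before [T], and the factorization through
    [P + K t] gives [det R3 > 0]. *)

(** * Euclidean inner product and norm on column vectors *)

Section Vectors.
Variable R : realType.
Implicit Types (n k : nat).

Lemma dotvE n (u v : 'cV[R]_n) : dotv u v = \sum_i u i 0 * v i 0.
Proof. by rewrite /dotv mxE; apply: eq_bigr => i _; rewrite mxE. Qed.

Lemma dotvC n (u v : 'cV[R]_n) : dotv u v = dotv v u.
Proof. by rewrite !dotvE; apply: eq_bigr => i _; rewrite mulrC. Qed.

Lemma dotvDl n (u v w : 'cV[R]_n) : dotv (u + v) w = dotv u w + dotv v w.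
Proof. by rewrite /dotv linearD mulmxDl mxE. Qed.

Lemma dotvDr n (u v w : 'cV[R]_n) : dotv w (u + v) = dotv w u + dotv w v.
Proof. by rewrite /dotv mulmxDr mxE. Qed.

Lemma dotvZl n a (u v : 'cV[R]_n) : dotv (a *: u) v = a * dotv u v.
Proof. by rewrite /dotv linearZ -scalemxAl mxE. Qed.

Lemma dotvZr n a (u v : 'cV[R]_n) : dotv u (a *: v) = a * dotv u v.
Proof. by rewrite /dotv -scalemxAr mxE. Qed.

Lemma dotvNl n (u v : 'cV[R]_n) : dotv (- u) v = - dotv u v.
Proof. by rewrite -scaleN1r dotvZl mulN1r. Qed.

Lemma dotvNr n (u v : 'cV[R]_n) : dotv u (- v) = - dotv u v.
Proof. by rewrite dotvC dotvNl dotvC. Qed.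

Lemma dotv0l n (u : 'cV[R]_n) : dotv 0 u = 0.
Proof. by rewrite -(scale0r 0) dotvZl mul0r. Qed.

Lemma dotv0r n (u : 'cV[R]_n) : dotv u 0 = 0.
Proof. by rewrite dotvC dotv0l. Qed.

Lemma dotv_mulmx n k (M : 'M[R]_(n, k)) u v :
  dotv u (M *m v) = dotv (M^T *m u) v.
Proof. by rewrite /dotv trmx_mul trmxK mulmxA. Qed.

Lemma dotv_ge0 n (u : 'cV[R]_n) : 0 <= dotv u u.
Proof. by rewrite dotvE sumr_ge0// => i _; rewrite -expr2 sqr_ge0. Qed.

Lemma dotv_eq0 n (u : 'cV[R]_n) : dotv u u = 0 -> u = 0.
Proof.
rewrite dotvE => /eqP; rewrite psumr_eq0; last first.
  by move=> i _; rewrite -expr2 sqr_ge0.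
move=> /allP u0; apply/matrixP => i j; rewrite ord1 mxE.
by apply/eqP; have := u0 i (mem_index_enum i); rewrite /= mulf_eq0 orbb.
Qed.

Lemma enorm_sqr n (u : 'cV[R]_n) : enorm u ^+ 2 = dotv u u.
Proof.
rewrite /enorm sqr_sqrtr; last by rewrite sumr_ge0// => i _; rewrite sqr_ge0.
by rewrite dotvE; apply: eq_bigr => i _; rewrite expr2.
Qed.

Lemma enorm_ge0 n (u : 'cV[R]_n) : 0 <= enorm u.
Proof. exact: sqrtr_ge0. Qed.

Lemma enorm0 n : enorm (0 : 'cV[R]_n) = 0.
Proof. by apply/eqP; rewrite -sqrf_eq0 enorm_sqr dotv0l. Qed.

Lemma enorm_eq0 n (u : 'cV[R]_n) : enorm u = 0 -> u = 0.
Proof. by move=> u0; apply: dotv_eq0; rewrite -enorm_sqr u0 expr0n. Qed.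

Lemma enormZ n a (u : 'cV[R]_n) : enorm (a *: u) = `|a| * enorm u.
Proof.
apply/eqP; rewrite -(@eqrXn2 _ 2)// ?mulr_ge0 ?enorm_ge0//.
by rewrite exprMn !enorm_sqr dotvZl dotvZr real_normK ?num_real// mulrA expr2.
Qed.

Lemma enormN n (u : 'cV[R]_n) : enorm (- u) = enorm u.
Proof. by rewrite -scaleN1r enormZ normrN normr1 mul1r. Qed.

Lemma dotv_le n (u v : 'cV[R]_n) : `|dotv u v| <= enorm u * enorm v.
Proof.
have [v0|v0] := eqVneq (dotv v v) 0.
  by rewrite (dotv_eq0 v0) dotv0r enorm0 normr0 mulr0.
rewrite -(@ler_pXn2r _ 2)// ?nnegrE ?mulr_ge0 ?enorm_ge0//.
rewrite exprMn !enorm_sqr real_normK ?num_real//.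
have vgt0 : 0 < dotv v v by rewrite lt_neqAle eq_sym v0 dotv_ge0.
have := dotv_ge0 (dotv v v *: u - dotv u v *: v).
rewrite !(dotvDl, dotvDr, dotvNl, dotvNr, dotvZl, dotvZr) (dotvC v u).
set a := dotv u u; set b := dotv v v in vgt0 *; set c := dotv u v => h.
by rewrite -(ler_pM2r vgt0); nra.
Qed.

Lemma enormD_sqr n (u v : 'cV[R]_n) :
  enorm (u + v) ^+ 2 = enorm u ^+ 2 + 2 * dotv u v + enorm v ^+ 2.
Proof. by rewrite !enorm_sqr !(dotvDl, dotvDr) (dotvC v u); ring. Qed.

Lemma enormD n (u v : 'cV[R]_n) : enorm (u + v) <= enorm u + enorm v.
Proof.
rewrite -(@ler_pXn2r _ 2)// ?nnegrE ?addr_ge0 ?enorm_ge0//.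
rewrite sqrrD enormD_sqr.
have := le_trans (ler_norm _) (dotv_le u v).
by rewrite mulr2n; lra.
Qed.

Lemma enormB n (u v : 'cV[R]_n) : enorm (u - v) <= enorm u + enorm v.
Proof. by rewrite (le_trans (enormD _ _))// enormN. Qed.

Lemma coord_le_enorm n (u : 'cV[R]_n) i : `|u i 0| <= enorm u.
Proof.
rewrite -(@ler_pXn2r _ 2)// ?nnegrE ?enorm_ge0// enorm_sqr dotvE.
rewrite real_normK ?num_real// (bigD1 i)//= expr2 lerDl.
by rewrite sumr_ge0// => j _; rewrite -expr2 sqr_ge0.
Qed.

Lemma enorm_mulmx n k (M : 'M[R]_(n, k)) : exists2 c : R, 0 < c &
  forall v, enorm (M *m v) <= c * enorm v.
Proof.
have bound : exists2 c : R, 0 <= c & forall v, dotv (M *m v) (M *m v) <= c * dotv v v.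
  exists (\sum_i dotv (row i M)^T (row i M)^T).
    by rewrite sumr_ge0// => i _; exact: dotv_ge0.
  move=> v; rewrite [leLHS]dotvE mulr_suml ler_sum// => i _.
  have -> : (M *m v) i 0 = dotv (row i M)^T v.
    by rewrite /dotv trmxK -row_mul [RHS]mxE.
  have := dotv_le (row i M)^T v.
  move=> /(lerXn2r 2)-/(_ (normr_ge0 _) (mulr_ge0 (enorm_ge0 _) (enorm_ge0 _))).
  by rewrite exprMn !enorm_sqr real_normK ?num_real// expr2.
have [c c0 cM] := bound.
(* The added 1 keeps the constant positive even for [M = 0], so that one can divide by it. *)
exists (Num.sqrt c + 1); first by rewrite ltr_wpDl ?sqrtr_ge0.
move=> v; apply: (@le_trans _ _ (Num.sqrt c * enorm v)); last first.
  by rewrite ler_wpM2r ?enorm_ge0// lerDl.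
rewrite -(@ler_pXn2r _ 2)// ?nnegrE ?mulr_ge0 ?sqrtr_ge0 ?enorm_ge0//.
by rewrite exprMn !enorm_sqr sqr_sqrtr//.
Qed.

End Vectors.

(** * Positive semidefinite matrices and Minkowski's determinant inequality *)

Section PositiveSemidefinite.
Variable R : realType.
Implicit Types (n k : nat).

Definition psd n (M : 'M[R]_n) :=
  M^T = M /\ forall v : 'cV_n, 0 <= dotv v (M *m v).

Lemma psdD n (M N : 'M[R]_n) : psd M -> psd N -> psd (M + N).
Proof.
move=> [sM pM] [sN pN]; split; first by rewrite linearD/= sM sN.
by move=> v; rewrite mulmxDl dotvDr addr_ge0.
Qed.

Lemma psd_congr n k (C : 'M[R]_(k, n)) (M : 'M[R]_n) :
  psd M -> psd (C *m M *m C^T).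
Proof.
move=> [sM pM]; split; first by rewrite !trmx_mul trmxK sM mulmxA.
by move=> v; rewrite -!mulmxA dotv_mulmx.
Qed.

Lemma psd_dr n k (M : 'M[R]_(n + k)) : psd M -> psd (drsubmx M).
Proof.
move=> pM; have := psd_congr (row_mx (0 : 'M[R]_(k, n)) 1%:M) pM.
rewrite tr_row_mx trmx0 trmx1 -{1}(submxK M) mul_row_block mul_row_col.
by rewrite !mul0mx !mul1mx !mulmx0 !add0r mulmx1.
Qed.

Lemma dotv_delta n (M : 'M[R]_n) i j :
  dotv (delta_mx i 0) (M *m delta_mx j 0) = M i j.
Proof. by rewrite /dotv trmx_delta -rowE -colE !mxE. Qed.

Lemma psd_diag_ge0 n (M : 'M[R]_n) i : psd M -> 0 <= M i i.
Proof. by move=> [_ /(_ (delta_mx i 0))]; rewrite dotv_delta. Qed.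

(** On [s e_i + e_j] the form is [2 s M i j + M j j], affine in [s]; it can stay nonnegative only if
    its slope vanishes. *)
Lemma psd_diag0 n (M : 'M[R]_n) i j : psd M -> M i i = 0 -> M i j = 0.
Proof.
move=> [sM pM] Mi0.
have Mji : M j i = M i j by rewrite -{1}sM mxE.
have h s : 0 <= 2 * s * M i j + M j j.
  have := pM (s *: delta_mx i 0 + delta_mx j 0).
  rewrite mulmxDr -scalemxAr !(dotvDl, dotvDr, dotvZl, dotvZr) !dotv_delta.
  by rewrite Mi0 Mji; lra.
have := h (- (M j j + 1) / M i j * 2^-1).
have [//|M0] := eqVneq (M i j) 0.
have -> : 2 * (- (M j j + 1) / M i j * 2^-1) * M i j = - (M j j + 1) by field.
by lra.
Qed.

(* One step of Gaussian elimination: [S] is the Schur complement. *)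
Lemma psd_eliminate n (M : 'M[R]_(1 + n)) : psd M -> 0 < M 0 0 ->
  exists E S, [/\ \det E = 1, E *m M *m E^T = block_mx (M 0 0)%:M 0 0 S,
    psd S & forall i, S i i <= M (rshift 1 i) (rshift 1 i)].
Proof.
move=> pM a_gt0; set a := M 0 0 in a_gt0 *; have a0 := lt0r_neq0 a_gt0.
have := pM.1; rewrite -{1 2}(submxK M) tr_block_mx => /eq_block_mx[_ _ sdl _].
have ulE : ulsubmx M = a%:M.
  apply/matrixP => i j; rewrite !ord1 !mxE eqxx mulr1n /a.
  by congr (M _ _); apply: val_inj.
pose b := ursubmx M; pose S := drsubmx M - a^-1 *: (b^T *m b).
pose E : 'M[R]_(1 + n) := block_mx 1%:M 0 (- a^-1 *: b^T) 1%:M.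
have detE : \det E = 1 by rewrite det_lblock !det1 mulr1.
have EM : E *m M *m E^T = block_mx a%:M 0 0 S.
  rewrite -(submxK M) ulE -/b -sdl -/b /E tr_block_mx !mulmx_block.
  rewrite !(trmx0, trmx1, mul1mx, mulmx1, mul0mx, mulmx0, addr0, add0r).
  rewrite linearZ/= trmxK -!scalemxAl -!scalemxAr mul_mx_scalar mul_scalar_mx.
  rewrite !scalerA mulNr mulVf// !scaleN1r !addNr.
  by rewrite mul0mx scaler0 add0r scaleNr addrC.
exists E, S; split => //.
  by have := psd_dr (psd_congr E pM); rewrite EM block_mxKdr.
move=> i; rewrite !mxE big_ord1 !mxE -expr2 lerBlDr lerDl.
by rewrite mulr_ge0 ?sqr_ge0// invr_ge0 ltW.
Qed.

Lemma psd_row0_det0 n (M : 'M[R]_n.+1) : psd M -> M 0 0 = 0 -> \det M = 0.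
Proof.
move=> pM M0; rewrite (expand_det_row _ 0) big1// => j _.
by rewrite (psd_diag0 _ pM M0) mul0r.
Qed.

(** Induction by elimination: a zero pivot kills its whole row, and otherwise the determinant splits
    off the pivot while the diagonal of the Schur complement only decreases. *)
Lemma hadamard_psd n (M : 'M[R]_n) : psd M -> 0 <= \det M <= \prod_i M i i.
Proof.
elim: n M => [|n IH] M pM; first by rewrite det_mx00 big_ord0 ler01 lexx.
have := psd_diag_ge0 0 pM; rewrite le_eqVlt => /predU1P[/esym M0|a_gt0].
  rewrite (psd_row0_det0 pM M0) lexx/= prodr_ge0// => i _.
  exact: psd_diag_ge0.
have [E [S [dE EM pS Sle]]] := @psd_eliminate n M pM a_gt0.
have /andP[S0 S1] := IH _ pS.
have detM : \det M = M 0 0 * \det S.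
  have := congr1 determinant EM.
  by rewrite !det_mulmx det_tr dE mul1r mulr1 det_ublock det_scalar1.
rewrite detM mulr_ge0 ?(ltW a_gt0)//= big_ord_recl ler_pM2l//.
rewrite (le_trans S1)// ler_prod// => i _; rewrite psd_diag_ge0//=.
by have := Sle i; rewrite -!rshift1.
Qed.

(** A Cholesky factorization: eliminate, scale the pivot by its inverse square root, recurse on the
    Schur complement. Nonsingularity excludes a zero pivot. *)
Lemma psd_whiten n (M : 'M[R]_n) : psd M -> \det M != 0 ->
  exists2 C, C \in unitmx & C *m M *m C^T = 1%:M.
Proof.
elim: n M => [|n IH] M pM dM.
  by exists 1%:M; rewrite ?unitmx1//; apply/matrixP => -[].
have := psd_diag_ge0 0 pM; rewrite le_eqVlt => /predU1P[/esym M0|a_gt0].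
  by rewrite (psd_row0_det0 pM M0) eqxx in dM.
have [E [S [dE EM pS _]]] := @psd_eliminate n M pM a_gt0.
have dS : \det S != 0.
  have := congr1 determinant EM.
  rewrite !det_mulmx det_tr dE mul1r mulr1 det_ublock det_scalar1 => detM.
  by move: dM; rewrite detM mulf_eq0 negb_or => /andP[].
have [C uC CS] := IH _ pS dS.
pose s := (Num.sqrt (M 0 0))^-1.
have s0 : s != 0 by rewrite invr_neq0// gt_eqF// sqrtr_gt0.
pose D : 'M[R]_(1 + n) := block_mx s%:M 0 0 C.
exists (D *m E : 'M[R]_(1 + n)).
  rewrite unitmxE det_mulmx dE mulr1 (@det_ublock _ 1 n) det_scalar1 unitfE mulf_neq0//.
  by rewrite -unitfE -unitmxE.
have -> : D *m E *m M *m (D *m E)^T = D *m (E *m M *m E^T) *m D^T.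
  by rewrite trmx_mul !mulmxA.
rewrite EM /D tr_block_mx !mulmx_block.
rewrite !(trmx0, mul0mx, mulmx0, addr0, add0r) tr_scalar_mx CS -!scalar_mxM.
rewrite (_ : s * M 0 0 * s = 1) -?scalar_mx_block//.
rewrite mulrAC -expr2 exprVn sqr_sqrtr ?ltW// mulVf//.
exact: lt0r_neq0.
Qed.

(** Whitening writes the form as the squared norm of [invmx C^T *m v]. *)
Lemma psd_ker n (M : 'M[R]_n) v : psd M -> \det M != 0 ->
  dotv v (M *m v) = 0 -> v = 0.
Proof.
move=> pM dM; have [C uC CM] := psd_whiten pM dM.
have uCT : C^T \in unitmx by rewrite unitmx_tr.
rewrite -(mulKVmx uCT v); move: (invmx C^T *m v) => w.
rewrite -[X in dotv X]/(C^T *m w) -dotv_mulmx !mulmxA CM mul1mx.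
by move=> /dotv_eq0 ->; rewrite mulmx0.
Qed.

Lemma rootn_ge0 n (a : R) : 0 <= a -> 0 <= rootn n a.
Proof. by move=> a0; rewrite mulr_ge0 ?powR_ge0// sgr_ge0. Qed.

Lemma rootn_gt0 n (a : R) : 0 < a -> 0 < rootn n a.
Proof.
by move=> a0; rewrite mulr_gt0 ?sgr_gt0// powR_gt0// normr_gt0 lt0r_neq0.
Qed.

(** No sign condition: the sign and the power of the absolute value are each multiplicative. This
    later lets the parity sign of [det R3(-s)] be factored out. *)
Lemma rootnM n (a b : R) : rootn n (a * b) = rootn n a * rootn n b.
Proof. by rewrite /rootn sgrM normrM powRM//; ring. Qed.

Lemma rootn1 n : rootn n (1 : R) = 1.
Proof. by rewrite /rootn sgr1 normr1 powR1 mulr1. Qed.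

Lemma rootn0 n : rootn n (0 : R) = 0.
Proof. by rewrite /rootn sgr0 mul0r. Qed.

Lemma rootnV n (a : R) : rootn n a^-1 = (rootn n a)^-1.
Proof.
have [->|a0] := eqVneq a 0; first by rewrite invr0 rootn0 invr0.
have : rootn n a * rootn n a^-1 = 1 by rewrite -rootnM mulfV// rootn1.
move=> h; rewrite -[RHS]mulr1 -h mulKf//; apply/eqP => ra0.
by move: h; rewrite ra0 mul0r => /esym/eqP; rewrite oner_eq0.
Qed.

Lemma rootnE n (a : R) : (0 < n)%N -> 0 <= a -> rootn n a = a `^ n%:R^-1.
Proof.
move=> n0; rewrite le_eqVlt => /predU1P[<-|a0].
  by rewrite rootn0 powR0// invr_neq0// pnatr_eq0 -lt0n.
by rewrite /rootn gtr0_sg// mul1r gtr0_norm.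
Qed.

Lemma ler_rootn n (a b : R) : (0 < n)%N -> 0 <= a -> a <= b ->
  rootn n a <= rootn n b.
Proof.
move=> n0 a0 ab; rewrite !rootnE// ?(le_trans a0)//.
by apply: ge0_ler_powR; rewrite ?invr_ge0 ?ler0n ?nnegrE ?(le_trans a0).
Qed.

Lemma rootnX n (a : R) : (0 < n)%N -> 0 <= a -> rootn n (a ^+ n) = a.
Proof.
move=> n0 a0; rewrite rootnE ?exprn_ge0// -powR_mulrn// -powRrM mulfV ?powRr1//.
by rewrite pnatr_eq0 -lt0n.
Qed.

(** Hadamard's bound followed by the arithmetic-geometric mean inequality on the diagonal. *)
Lemma rootn_det_psd n (M : 'M[R]_n) : (0 < n)%N -> psd M ->
  rootn n (\det M) <= \tr M / n%:R.
Proof.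
move=> n0 pM; have /andP[d0 d1] := hadamard_psd pM.
have tr0 : 0 <= \tr M by rewrite sumr_ge0// => i _; exact: psd_diag_ge0.
rewrite -[leRHS](rootnX n0) ?divr_ge0// ler_rootn// (le_trans d1)//.
have [] := @leif_AGM R _ predT (fun i : 'I_n => M i i).
  by move=> i _; exact: psd_diag_ge0.
by rewrite cardT size_enum_ord.
Qed.

(* After whitening [N + M], both sides become traces of matrices summing to the identity. *)
Lemma minkowski_det n (N M : 'M[R]_n) : (0 < n)%N -> psd N -> psd M ->
  \det N != 0 -> rootn n (\det N) + rootn n (\det M) <= rootn n (\det (N + M)).
Proof.
move=> n0 pN pM dN.
have dNM : \det (N + M) != 0.
  have [C uC CN] := psd_whiten pN dN.
  (* On a kernel vector of [N + M] the two nonnegative forms sum to 0, so the form of [N] vanishes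
     there, against its definiteness. *)
  apply/det0P => -[v v0 vNM]; case/negP: v0; rewrite -trmx_eq0; apply/eqP.
  apply: (psd_ker pN dN); apply/eqP; rewrite eq_le pN.2 andbT.
  have /eqP : dotv v^T ((N + M) *m v^T) = 0.
    by rewrite -[N + M]trmxK -trmx_mul (psdD pN pM).1 vNM trmx0 dotv0r.
  by rewrite mulmxDl dotvDr addr_eq0 => /eqP ->; rewrite oppr_le0 pM.2.
have [C uC CNM] := psd_whiten (psdD pN pM) dNM.
have [c c0 detC] : exists2 c : R, 0 < c &
    forall X, \det (C *m X *m C^T) = c * \det X.
  exists (\det C ^+ 2); last by move=> X; rewrite !det_mulmx det_tr mulrAC.
  by rewrite lt_neqAle sqr_ge0 eq_sym sqrf_eq0 andbT -unitfE -unitmxE.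
have trs : \tr (C *m N *m C^T) + \tr (C *m M *m C^T) = n%:R.
  by rewrite -mxtraceD -mulmxDl -mulmxDr CNM mxtrace1.
have G1 : rootn n c * rootn n (\det (N + M)) = 1.
  by rewrite -rootnM -detC CNM det1 rootn1.
have nR0 : n%:R != 0 :> R by rewrite pnatr_eq0 -lt0n.
rewrite -(ler_pM2l (rootn_gt0 n c0)) G1 mulrDr -2!rootnM -2!detC.
apply: le_trans (lerD (rootn_det_psd n0 (psd_congr C pN))
  (rootn_det_psd n0 (psd_congr C pM))) _.
by rewrite -mulrDl trs divff.
Qed.

End PositiveSemidefinite.

(** * Entrywise calculus for matrix-valued functions *)

Section MatrixDerivative.
Variable R : realType.
Implicit Types (n k : nat).

Definition mderiv n k (F : R -> 'M[R]_(n, k)) (t : R) (D : 'M[R]_(n, k)) :=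
  forall i j, is_derive t 1 (fun s => F s i j) (D i j).

Lemma mderiv_cst n k (C : 'M[R]_(n, k)) t : mderiv (fun=> C) t 0.
Proof. by move=> i j; rewrite mxE; exact: is_derive_cst. Qed.

Lemma mderivM n k l (F : R -> 'M[R]_(n, k)) (G : R -> 'M[R]_(k, l)) t D E :
  mderiv F t D -> mderiv G t E ->
  mderiv (fun s => F s *m G s) t (D *m G t + F t *m E).
Proof.
move=> dF dG i j.
have -> : (fun s => (F s *m G s) i j) =
    \sum_(a < k) ((fun s => F s i a) * (fun s => G s a j)).
  by apply/funext => s; rewrite mxE fct_sumE.
apply: is_derive_eq; first by apply: is_derive_sum => a; exact: is_deriveM.
rewrite !mxE -big_split/=; apply: eq_bigr => a _.
by rewrite addrC /GRing.scale/= [G t a j * _]mulrC.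
Qed.

Lemma mderivMl n k l (C : 'M[R]_(n, k)) (F : R -> 'M[R]_(k, l)) t D :
  mderiv F t D -> mderiv (fun s => C *m F s) t (C *m D).
Proof.
by move=> dF; have := mderivM (mderiv_cst C t) dF; rewrite mul0mx add0r.
Qed.

Lemma mderivMr n k l (C : 'M[R]_(k, l)) (F : R -> 'M[R]_(n, k)) t D :
  mderiv F t D -> mderiv (fun s => F s *m C) t (D *m C).
Proof.
by move=> dF; have := mderivM dF (mderiv_cst C t); rewrite mulmx0 addr0.
Qed.

Lemma mderiv_tr n k (F : R -> 'M[R]_(n, k)) t D :
  mderiv F t D -> mderiv (fun s => (F s)^T) t D^T.
Proof.
move=> dF i j; rewrite mxE.
by rewrite (_ : (fun s => _) = (fun s => F s j i))//; apply/funext => s; rewrite mxE.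
Qed.

Lemma mderivD n k (F G : R -> 'M[R]_(n, k)) t D E :
  mderiv F t D -> mderiv G t E -> mderiv (fun s => F s + G s) t (D + E).
Proof.
move=> dF dG i j; rewrite mxE.
rewrite (_ : (fun s => _) = (fun s => F s i j) + (fun s => G s i j)).
  exact: is_deriveD.
by apply/funext => s; rewrite mxE.
Qed.

Lemma mderiv_opp_arg n k (F : R -> 'M[R]_(n, k)) t D :
  mderiv F (- t) D -> mderiv (fun s => F (- s)) t (- D).
Proof.
move=> dF i j; rewrite mxE -mulrN1.
exact: (@is_derive1_comp _ (fun s => F s i j) -%R).
Qed.

Lemma mderiv_shift n k (F : R -> 'M[R]_(n, k)) a t D :
  mderiv F (t + a) D -> mderiv (fun s => F (s + a)) t D.
Proof.
move=> dF i j; rewrite -[D i j]mulr1.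
exact: (@is_derive1_comp _ (fun s => F s i j) (shift a) t _ _ (dF i j) (is_derive_shift _ _ _)).
Qed.

Lemma mderiv_ulsubmx n1 n2 k1 k2 (F : R -> 'M[R]_(n1 + n2, k1 + k2)) t D :
  mderiv F t D -> mderiv (fun s => ulsubmx (F s)) t (ulsubmx D).
Proof.
move=> dF i j; rewrite 2!mxE.
have -> : (fun s => ulsubmx (F s) i j) = (fun s => F s (lshift n2 i) (lshift k2 j)).
  by apply/funext => s; rewrite !mxE.
exact: dF.
Qed.

Lemma mderiv_ursubmx n1 n2 k1 k2 (F : R -> 'M[R]_(n1 + n2, k1 + k2)) t D :
  mderiv F t D -> mderiv (fun s => ursubmx (F s)) t (ursubmx D).
Proof.
move=> dF i j; rewrite 2!mxE.
have -> : (fun s => ursubmx (F s) i j) = (fun s => F s (lshift n2 i) (rshift k1 j)).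
  by apply/funext => s; rewrite !mxE.
exact: dF.
Qed.

Lemma mderiv_dlsubmx n1 n2 k1 k2 (F : R -> 'M[R]_(n1 + n2, k1 + k2)) t D :
  mderiv F t D -> mderiv (fun s => dlsubmx (F s)) t (dlsubmx D).
Proof.
move=> dF i j; rewrite 2!mxE.
have -> : (fun s => dlsubmx (F s) i j) = (fun s => F s (rshift n1 i) (lshift k2 j)).
  by apply/funext => s; rewrite !mxE.
exact: dF.
Qed.

Lemma mderiv_drsubmx n1 n2 k1 k2 (F : R -> 'M[R]_(n1 + n2, k1 + k2)) t D :
  mderiv F t D -> mderiv (fun s => drsubmx (F s)) t (drsubmx D).
Proof.
move=> dF i j; rewrite 2!mxE.
have -> : (fun s => drsubmx (F s) i j) = (fun s => F s (rshift n1 i) (rshift k1 j)).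
  by apply/funext => s; rewrite !mxE.
exact: dF.
Qed.

Lemma mderiv0_cst n k (F : R -> 'M[R]_(n, k)) t s :
  (forall u, mderiv F u 0) -> F t = F s.
Proof.
move=> dF; apply/matrixP => i j.
apply: (@is_derive_0_is_cst _ (fun u => F u i j)) => u.
by have := dF u i j; rewrite mxE.
Qed.

Lemma mderiv_unique n k (F : R -> 'M[R]_(n, k)) t D E :
  mderiv F t D -> mderiv F t E -> D = E.
Proof.
move=> dD dE; apply/matrixP => i j.
by have [_ <-] := dD i j; have [_ <-] := dE i j.
Qed.

Lemma mderiv_continuous n k (F : R -> 'M[R]_(n, k)) t D i j :
  mderiv F t D -> {for t, continuous (fun s => F s i j)}.
Proof.
by move=> /(_ i j)[dF _]; exact/differentiable_continuous/derivable1_diffP.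
Qed.

Lemma derivable_det n (F : R -> 'M[R]_n) t :
  (forall i j, derivable (fun s => F s i j) t 1) ->
  derivable (fun s => \det (F s)) t 1.
Proof.
move=> dF; rewrite /determinant.
have dprod (p : {perm 'I_n}) (r : seq 'I_n) :
    derivable (fun s => \prod_(i <- r) F s i (p i)) t 1.
  elim: r => [|i r IH].
    under eq_fun do rewrite big_nil.
    exact: derivable_cst.
  under eq_fun do rewrite big_cons.
  exact: (@derivableM _ _ (fun s => F s i (p i))
    (fun s => \prod_(i <- r) F s i (p i)) t 1 (dF _ _) IH).
have dsum (r : seq {perm 'I_n}) : derivable (fun s =>
    \sum_(p <- r) (-1) ^+ p * \prod_(i < n) F s i (p i)) t 1.
  elim: r => [|p r IH].
    under eq_fun do rewrite big_nil.
    exact: derivable_cst.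
  under eq_fun do rewrite big_cons.
  exact: (derivableD (derivableM (derivable_cst ((-1) ^+ p : R) t 1)
    (dprod p (index_enum 'I_n))) IH).
exact: dsum.
Qed.

(** Derivability is read off the cofactor formula, valid near [t] because the determinant stays
    nonzero; the value is then forced by differentiating [F s *m invmx (F s) = 1]. *)
Lemma mderiv_inv n (F : R -> 'M[R]_n) t D : mderiv F t D ->
  \det (F t) != 0 ->
  mderiv (fun s => invmx (F s)) t (- (invmx (F t) *m D *m invmx (F t))).
Proof.
move=> dF Ft0.
have dE i j : derivable (fun s => F s i j) t 1 by have [] := dF i j.
have ddet := derivable_det dE.
have near_unit : \forall s \near t, F s \in unitmx.
  have : {for t, continuous (fun s => \det (F s))}.
    exact/differentiable_continuous/derivable1_diffP.
  move=> /(_ [set x | x != 0]) /=.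
  rewrite nbhs_filterE => h; near=> s; rewrite unitmxE unitfE; near: s; apply: h.
  exact: open_nbhs_nbhs.
have dinv i j : derivable (fun s => invmx (F s) i j) t 1.
  apply: (@near_eq_derivable _ _ _
    (fun s => (\det (F s))^-1 * cofactor (F s) j i)); last first.
    apply: derivableM; first exact: derivableV.
    apply: derivableM; first exact: derivable_cst.
    apply: derivable_det => a b.
    suff -> : (fun s => row' j (col' i (F s)) a b) =
        (fun s => F s (lift j a) (lift i b)).
      exact: dE.
    by apply/funext => s; rewrite !mxE.
  by near=> s; rewrite /invmx (near near_unit s)// !mxE.
have [I dI] : exists I, mderiv (fun s => invmx (F s)) t I.
  exists (\matrix_(i, j) 'D_1 (fun s => invmx (F s) i j) t) => i j.
  by rewrite [X in is_derive _ _ _ X]mxE; exact/derivableP/dinv.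
have d1 : mderiv (fun s => F s *m invmx (F s)) t 0.
  move=> i j; apply: (@near_eq_is_derive _ _ _ (fun=> (1%:M : 'M[R]_n) i j)).
    by near=> s; rewrite mulmxV// (near near_unit s).
  exact: mderiv_cst.
have FI := mderiv_unique (mderivM dF dI) d1.
have Fu : F t \in unitmx by rewrite unitmxE unitfE.
suff <- : I = - (invmx (F t) *m D *m invmx (F t)) by [].
rewrite -[LHS](mulKmx Fu) -mulmxA -mulmxN; congr (_ *m _).
by apply/eqP; rewrite -addr_eq0 addrC FI.
Unshelve. all: by end_near. Qed.

End MatrixDerivative.

(** * The matrix exponential as an entrywise power series *)

Section MatrixExponential.
Variable R : realType.
Implicit Types (n k : nat).

Lemma cvg_mx (T : Type) n k (F : set_system T) (f : T -> 'M[R]_(n, k))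
    (l : 'M[R]_(n, k)) : Filter F ->
  (forall i j, (fun x => f x i j) @ F --> l i j) -> f @ F --> l.
Proof.
move=> FF fl; apply/cvg_ballP => e e0.
have : \forall x \near F, forall ij : 'I_n * 'I_k,
    ball (l ij.1 ij.2) e (f x ij.1 ij.2).
  by apply: filter_forall => ij; exact: (cvg_ball (fl _ _)).
apply: filterS => x h; split=> // i j; exact: (h (i, j)).
Qed.

Lemma cvg_sum (T I : Type) (F : set_system T) (r : seq I) (f : I -> T -> R)
    (l : I -> R) : Filter F -> (forall i, f i @ F --> l i) ->
  (fun x => \sum_(i <- r) f i x) @ F --> \sum_(i <- r) l i.
Proof.
move=> FF fl; elim: r => [|i r IH].
  by rewrite big_nil; under eq_fun do rewrite big_nil; exact: cvg_cst.
by rewrite big_cons; under eq_fun do rewrite big_cons; exact: cvgD.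
Qed.

(** Geometric growth of [f] loses against the factorial: the terms are dominated by [C] times those
    of [exp (r * |t|)]. *)
Lemma cvg_pseries_fact (f : nat -> R) (C r t : R) : 0 <= C -> 0 <= r ->
  (forall j, `|f j| <= C * r ^+ j) ->
  cvgn (pseries (fun j => (j`!%:R)^-1 * f j) t).
Proof.
move=> C0 r0 fb; apply: normed_cvg.
apply: (@series_le_cvg _ _ (fun j => C * exp_coeff (r * `|t|) j)) => //.
- by move=> j; exact: normr_ge0.
- by move=> j; rewrite mulr_ge0// divr_ge0// exprn_ge0// mulr_ge0.
- move=> j; rewrite /exp_coeff /= !normrM normrX normfV normr_nat exprMn.
  rewrite [leRHS](_ : _ = j`!%:R^-1 * (C * r ^+ j) * `|t| ^+ j); last by ring.
  by rewrite ler_wpM2r ?exprn_ge0// ler_wpM2l.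
have -> : series (fun j => C * exp_coeff (r * `|t|) j) =
    (fun N => C * series (exp_coeff (r * `|t|)) N).
  by apply/funext => N; rewrite /series/= mulr_sumr.
by apply: is_cvgM; [exact: is_cvg_cst|exact: is_cvg_series_exp_coeff].
Qed.

(** Termwise differentiation asks for convergence of the series and its first two formal derivatives
    at a radius beyond [|t|]. Each derivative shifts [f], which preserves the growth bound with [C]
    replaced by [C * r]. *)
Lemma is_derive_pseries_fact (f : nat -> R) (C r t : R) : 0 <= C -> 0 <= r ->
  (forall j, `|f j| <= C * r ^+ j) ->
  is_derive t (1 : R) (fun t => limn (pseries (fun j => (j`!%:R)^-1 * f j) t))
    (limn (pseries (fun j => (j`!%:R)^-1 * f j.+1) t)).
Proof.
move=> C0 r0 fb.
have dE (g : nat -> R) : pseries_diffs (fun j => (j`!%:R)^-1 * g j) =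
    (fun j => (j`!%:R)^-1 * g j.+1).
  apply/funext => j; rewrite /pseries_diffs factS natrM invfM mulrA mulVKf//.
have fb1 (g : nat -> R) C' : (forall j, `|g j| <= C' * r ^+ j) ->
    forall j, `|g j.+1| <= (C' * r) * r ^+ j.
  by move=> gb j; rewrite -mulrA -exprS.
rewrite -dE; apply: (@pseries_snd_diffs _ _ (`|t| + 1)).
- exact: cvg_pseries_fact fb.
- rewrite dE; apply: (@cvg_pseries_fact _ (C * r) r) => //.
    by rewrite mulr_ge0.
  exact: fb1.
- rewrite !dE; apply: (@cvg_pseries_fact (fun j => f j.+2) (C * r * r) r) => //.
    by rewrite !mulr_ge0.
  by apply: (fb1 (fun j => f j.+1)); exact: fb1.
- by rewrite [ltRHS]ger0_norm ?addr_ge0// ltrDl.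
Qed.

(** With [r] the sum of all absolute entries, each row sum is at most [r]. The factor 1 matches the
    shape [C * r ^+ j] of the series lemmas. *)
Lemma expmx_bound n (M : 'M[R]_n) : exists2 r : R, 0 <= r &
  forall j a b, `|(M ^+ j) a b| <= 1 * r ^+ j.
Proof.
pose r := \sum_a \sum_b `|M a b|.
have row_le a : \sum_b `|M a b| <= r.
  rewrite /r [leRHS](bigD1 a)//= lerDl sumr_ge0// => i _.
  by rewrite sumr_ge0.
exists r; first by rewrite sumr_ge0// => i _; rewrite sumr_ge0.
elim=> [|j IH] a b.
  by rewrite !expr0 mulr1 mxE; case: (a == b); rewrite ?normr1 ?normr0.
rewrite !exprS mxE mul1r (le_trans (ler_norm_sum _ _ _))//.
apply: (@le_trans _ _ (\sum_c `|M a c| * r ^+ j)).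
  apply: ler_sum => c _; rewrite normrM ler_wpM2l//.
  by have := IH c b; rewrite mul1r.
rewrite -mulr_suml ler_wpM2r// exprn_ge0//.
by rewrite sumr_ge0// => i _; rewrite sumr_ge0.
Qed.

Lemma scalemxX n (M : 'M[R]_n) t j : (t *: M) ^+ j = t ^+ j *: M ^+ j.
Proof.
elim: j => [|j IH]; first by rewrite !expr0 scale1r.
by rewrite !exprS IH -[LHS]/((_ *: _) *m (_ *: _)) -scalemxAl -scalemxAr scalerA.
Qed.

Lemma mexp_coord n (M : 'M[R]_n) t a b :
  mexp (t *: M) a b = limn (pseries (fun j => (j`!%:R)^-1 * (M ^+ j) a b) t).
Proof.
have [r r0 rb] := expmx_bound M.
pose L := \matrix_(a, b) limn (pseries (fun j => (j`!%:R)^-1 * (M ^+ j) a b) t).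
suff : series (fun j => (j`!%:R)^-1 *: ((t *: M) ^+ j)) @ \oo --> L.
  by move=> /cvg_lim; rewrite /mexp => -> //; rewrite mxE.
apply: cvg_mx => i j; rewrite mxE.
have -> : (fun N => series (fun j => (j`!%:R)^-1 *: ((t *: M) ^+ j)) N i j) =
    pseries (fun k => (k`!%:R)^-1 * (M ^+ k) i j) t.
  apply/funext => N; rewrite /series/= summxE; apply: eq_bigr => k _.
  by rewrite scalemxX !mxE/=; ring.
exact: (cvg_pseries_fact _ _ (fun k => rb k i j)).
Qed.

Lemma mexp_coordM n (M A B : 'M[R]_n) t a b :
  (A *m mexp (t *: M) *m B) a b =
  limn (pseries (fun j => (j`!%:R)^-1 * (A *m M ^+ j *m B) a b) t).
Proof.
have [r r0 rb] := expmx_bound M.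
apply/esym/cvg_lim => //.
have -> : pseries (fun j => (j`!%:R)^-1 * (A *m M ^+ j *m B) a b) t =
    (fun N => (\sum_c (\sum_d A a d * pseries (fun j => (j`!%:R)^-1 * (M ^+ j) d c) t N) * B c b)).
  apply/funext => N; rewrite /pseries /series/=.
  under eq_bigr do rewrite mxE mulr_sumr mulr_suml.
  rewrite exchange_big/=; apply: eq_bigr => c _.
  rewrite mulr_suml.
  under eq_bigr do rewrite mxE mulr_suml mulr_sumr mulr_suml.
  rewrite exchange_big/=; apply: eq_bigr => d _.
  rewrite -mulrA mulr_suml mulr_sumr; apply: eq_bigr => j _; ring.
rewrite mxE; apply: cvg_sum => c; apply: cvgM; last exact: cvg_cst.
rewrite mxE; apply: cvg_sum => d; apply: cvgM; first exact: cvg_cst.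
rewrite mexp_coord.
exact: (cvg_pseries_fact _ _ (fun k => rb k d c)).
Qed.

Lemma mderiv_mexp n (M : 'M[R]_n) t :
  mderiv (fun s => mexp (s *: M)) t (M *m mexp (t *: M)).
Proof.
have [r r0 rb] := expmx_bound M.
move=> i j.
rewrite -[M *m _]mulmx1 mexp_coordM.
under eq_fun do rewrite mexp_coord.
apply: is_derive_eq; first exact: (is_derive_pseries_fact t ler01 r0 (fun k => rb k i j)).
by congr (limn (pseries _ _)); apply/funext => k; rewrite exprS mulmx1.
Qed.

(** Both sides are the derivative of the exponential, according to whether [M ^+ j.+1] is split on
    the left or on the right. *)
Lemma mexp_comm n (M : 'M[R]_n) t : M *m mexp (t *: M) = mexp (t *: M) *m M.
Proof.
apply: mderiv_unique (@mderiv_mexp n M t) _.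
have [r r0 rb] := expmx_bound M.
move=> i j.
rewrite -[mexp _]mul1mx mexp_coordM.
under eq_fun do rewrite mexp_coord.
apply: is_derive_eq; first exact: (is_derive_pseries_fact t ler01 r0 (fun k => rb k i j)).
by congr (limn (pseries _ _)); apply/funext => k; rewrite exprSr mul1mx.
Qed.

Lemma mexp0 n (M : 'M[R]_n) : mexp (0 *: M) = 1%:M.
Proof.
apply/matrixP => i j; rewrite mexp_coord; apply/cvg_lim => //.
apply: cvg_near_cst; exists 1%N => // -[//|N] _.
rewrite /pseries /series/= big_nat_recl// big1 ?addr0.
  by rewrite expr0 mulr1 fact0 invr1 mul1r.
by move=> k _; rewrite expr0n mulr0.
Qed.

Lemma mexp_inv n (M : 'M[R]_n) t : mexp (t *: M) *m mexp (- t *: M) = 1%:M.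
Proof.
rewrite (mderiv0_cst (F := fun t => mexp (t *: M) *m mexp (- t *: M)) t 0).
  by rewrite oppr0 mexp0 mulmx1.
move=> u; have := mderivM (@mderiv_mexp n M u)
  (mderiv_opp_arg (@mderiv_mexp n M (- u))).
by rewrite mexp_comm mulmxN mulmxA subrr.
Qed.

(** The product [mexp (- s *: M) *m mexp ((s + t) *: M)] has zero derivative in [s], hence equals
    its value at [s = 0]. *)
Lemma mexpD n (M : 'M[R]_n) s t :
  mexp ((s + t) *: M) = mexp (s *: M) *m mexp (t *: M).
Proof.
have : mexp (- s *: M) *m mexp ((s + t) *: M) = mexp (t *: M).
  rewrite (mderiv0_cst (F := fun s => mexp (- s *: M) *m mexp ((s + t) *: M)) s 0).
    by rewrite oppr0 mexp0 mul1mx add0r.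
  move=> u; have := mderivM (mderiv_opp_arg (@mderiv_mexp n M (- u)))
    (mderiv_shift (@mderiv_mexp n M (u + t))).
  by rewrite mexp_comm mulNmx mulmxA addNr.
by move=> <-; rewrite mulmxA mexp_inv mul1mx.
Qed.

End MatrixExponential.

(** * The Hamiltonian flow, its symplectic identities and the Riccati matrix *)

Section HamiltonianFlow.
Variables (R : realType) (n m : nat).
Variables (A : 'M[R]_n) (B : 'M[R]_(n, m)) (Q : 'M[R]_n).
Hypothesis Qsym : Q^T = Q.

Local Notation Phi := (flow A B Q).
Local Notation G := (- (Omega R n *m Hmat A B Q)).
Local Notation S3 := (R3 A B Q).
Local Notation S4 := (R4 A B Q).

Definition R1 t : 'M[R]_n := ulsubmx (Phi t).
Definition R2 t : 'M[R]_n := ursubmx (Phi t).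

Lemma hamiltonian_blocks : G = block_mx (- A^T) (- Q) (B *m B^T) A.
Proof.
rewrite /Omega /Hmat mulmx_block !mul0mx !mul1mx !mulNmx !mul1mx !add0r !addr0.
by rewrite opp_block_mx !opprK.
Qed.

Lemma flowE t : Phi t = mexp (t *: G).
Proof. by rewrite /flow scaleNr scalerN. Qed.

Lemma flow0 : Phi 0 = 1%:M.
Proof. by rewrite flowE mexp0. Qed.

Lemma flowD s t : Phi (s + t) = Phi s *m Phi t.
Proof. by rewrite !flowE mexpD. Qed.

Lemma mderiv_flow t : mderiv Phi t (G *m Phi t).
Proof.
have -> : (Phi : R -> _) = (fun s => mexp (s *: G)).
  by apply/funext => s; rewrite flowE.
exact: mderiv_mexp.
Qed.

Lemma flow_blocks t : Phi t = block_mx (R1 t) (R2 t) (S3 t) (S4 t).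
Proof. by rewrite submxK. Qed.

(** The derivative of the left side is [Phi^T (G^T Omega + Omega G) Phi], and the bracket vanishes
    because [Q] and [B *m B^T] are symmetric. *)
Lemma flow_symplectic t : (Phi t)^T *m Omega R n *m Phi t = Omega R n.
Proof.
rewrite (mderiv0_cst (F := fun t => (Phi t)^T *m Omega R n *m Phi t) t 0).
  by rewrite flow0 trmx1 mul1mx mulmx1.
move=> u; have d := mderiv_flow u.
have := mderivM (mderivMr (Omega R n) (mderiv_tr d)) d.
suff GO : G^T *m Omega R n + Omega R n *m G = 0.
  have -> (X M O : 'M[R]_(n + n)) : (M *m X)^T *m O *m X + X^T *m O *m (M *m X) =
      X^T *m (M^T *m O + O *m M) *m X.
    by rewrite mulmxDr mulmxDl trmx_mul !mulmxA.
  by rewrite GO mulmx0 mul0mx.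
rewrite hamiltonian_blocks /Omega tr_block_mx !mulmx_block.
rewrite !(mul0mx, mulmx0, add0r, addr0, mul1mx, mulmx1, mulNmx, mulmxN).
rewrite add_block_mx trmx_mul !trmxK !raddfN/= trmxK Qsym.
by rewrite opprK !addNr !subrr -block_mx0.
Qed.

(** By symplecticity the inverse of the flow is its transpose conjugated by [Omega]; this is that
    identity read in blocks. *)
Lemma flow_opp t :
  Phi (- t) = block_mx (S4 t)^T (- (R2 t)^T) (- (S3 t)^T) (R1 t)^T.
Proof.
have Phi1 : Phi t *m Phi (- t) = 1%:M by rewrite -flowD subrr flow0.
have : Omega R n *m Phi (- t) = (Phi t)^T *m Omega R n.
  by rewrite -{1}(flow_symplectic t) -!mulmxA Phi1 mulmx1.
rewrite (flow_blocks t) (flow_blocks (- t)) /Omega tr_block_mx !mulmx_block.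
rewrite !(mul0mx, mulmx0, add0r, addr0, mul1mx, mulmx1, mulNmx, mulmxN).
by move=> /eq_block_mx[-> -> /oppr_inj-> <-]; rewrite opprK.
Qed.

Lemma R3_opp t : S3 (- t) = - (S3 t)^T.
Proof. by rewrite {1}/R3 flow_opp block_mxKdl. Qed.

Lemma R3_0 : S3 0 = 0.
Proof. by rewrite /R3 flow0 (scalar_mx_block n n 1) block_mxKdl. Qed.

Lemma R4_0 : S4 0 = 1%:M.
Proof. by rewrite /R4 flow0 (scalar_mx_block n n 1) block_mxKdr. Qed.

Lemma R3D s t : S3 (s + t) = S3 s *m R1 t + S4 s *m S3 t.
Proof.
by rewrite {1}/R3 flowD (flow_blocks s) (flow_blocks t) mulmx_block block_mxKdl.
Qed.

Lemma flow_R1R4 t : R1 t *m (S4 t)^T - R2 t *m (S3 t)^T = 1%:M.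
Proof.
have : Phi t *m Phi (- t) = 1%:M by rewrite -flowD subrr flow0.
rewrite flow_opp (flow_blocks t) mulmx_block (scalar_mx_block _ _ 1).
by move=> /eq_block_mx[<- _ _ _]; rewrite mulmxN.
Qed.

Lemma mderiv_flow_blocks t : mderiv Phi t
  (block_mx (- (A^T *m R1 t) - Q *m S3 t) (- (A^T *m R2 t) - Q *m S4 t)
            (B *m B^T *m R1 t + A *m S3 t) (B *m B^T *m R2 t + A *m S4 t)).
Proof.
have := mderiv_flow t.
by rewrite hamiltonian_blocks [X in _ *m X]flow_blocks mulmx_block !mulNmx.
Qed.

Lemma mderiv_R1 t : mderiv R1 t (- (A^T *m R1 t) - Q *m S3 t).
Proof. by have := mderiv_ulsubmx (mderiv_flow_blocks t); rewrite block_mxKul. Qed.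

Lemma mderiv_R2 t : mderiv R2 t (- (A^T *m R2 t) - Q *m S4 t).
Proof. by have := mderiv_ursubmx (mderiv_flow_blocks t); rewrite block_mxKur. Qed.

Lemma mderiv_R3 t : mderiv S3 t (B *m B^T *m R1 t + A *m S3 t).
Proof. by have := mderiv_dlsubmx (mderiv_flow_blocks t); rewrite block_mxKdl. Qed.

Lemma mderiv_R4 t : mderiv S4 t (B *m B^T *m R2 t + A *m S4 t).
Proof. by have := mderiv_drsubmx (mderiv_flow_blocks t); rewrite block_mxKdr. Qed.

(* Minus the initial covector of the extremal steering [v] to [0] in time [t]
   is [riccati t *m v]. *)
Definition riccati t := invmx (S3 t) *m S4 t.

Section Invertible.
Variable t : R.
Hypothesis S3t : \det (S3 t) != 0.

Lemma R3_unit : S3 t \in unitmx.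
Proof. by rewrite unitmxE unitfE. Qed.

Lemma R3_opp_unit : S3 (- t) \in unitmx.
Proof. by rewrite R3_opp -scaleN1r unitmxZ ?unitrN1// unitmx_tr R3_unit. Qed.

Lemma R3_riccati : S3 t *m riccati t = S4 t.
Proof. by rewrite mulKVmx// R3_unit. Qed.

(** The group law applied to [S3 (t - t) = 0] gives [S3 t *m R1 (- t) + S4 t *m S3 (- t) = 0]. *)
Lemma riccatiE : riccati t = - (R1 (- t) *m invmx (S3 (- t))).
Proof.
apply/eqP; rewrite -addr_eq0; apply/eqP.
have := R3D t (- t); rewrite subrr R3_0 => /esym h.
apply: (can_inj (mulKmx R3_unit)); rewrite mulmxDr R3_riccati mulmx0.
apply: (can_inj (mulmxK R3_opp_unit)); rewrite mul0mx mulmxDl -!mulmxA.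
by rewrite mulVmx ?R3_opp_unit// mulmx1 addrC.
Qed.

(** The backward expression of [riccatiE], rewritten with [flow_opp], is the transpose of the
    forward one. *)
Lemma riccati_sym : (riccati t)^T = riccati t.
Proof.
apply: (can_inj (mulKmx R3_unit)); rewrite R3_riccati; apply: trmx_inj.
rewrite trmx_mul trmxK; have /(congr1 (mulmx^~ (S3 (- t)))) := riccatiE.
rewrite mulNmx (mulmxKV R3_opp_unit) R3_opp [R1 _]/R1 flow_opp.
by rewrite block_mxKul mulmxN => /oppr_inj.
Qed.

Lemma riccati_diff s : \det (S3 s) != 0 ->
  riccati s - riccati t = invmx (S3 s) *m S3 (s - t) *m invmx (S3 (- t)).
Proof.
move=> S3s; have us : S3 s \in unitmx by rewrite unitmxE unitfE.
rewrite riccatiE opprK R3D mulmxDr mulmxDl mulKmx// addrC; congr (_ + _).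
by rewrite mulmxA mulmxK ?R3_opp_unit.
Qed.

(** In the derivative of [S3^-1 S4] the terms in [A] cancel, leaving [S3^-1 B B^T (R2 - R1 K)]; the
    bracket is minus the inverse transpose of [S3] by the symplectic relation [flow_R1R4]. *)
Lemma mderiv_riccati :
  mderiv riccati t (- (invmx (S3 t) *m B *m (invmx (S3 t) *m B)^T)).
Proof.
have KS : riccati t *m (S3 t)^T = (S4 t)^T.
  by rewrite -riccati_sym -trmx_mul R3_riccati.
have invS : R2 t - R1 t *m riccati t = - (invmx (S3 t))^T.
  have ut : (S3 t)^T \in unitmx by rewrite unitmx_tr R3_unit.
  apply: (can_inj (mulmxK ut)); rewrite mulNmx trmx_inv mulVmx// mulmxBl.
  by rewrite -(mulmxA (R1 t)) KS -(flow_R1R4 t) opprB.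
have := mderivM (mderiv_inv (mderiv_R3 t) S3t) (mderiv_R4 t).
set D := (X in mderiv _ _ X -> _); suff -> : D =
  - (invmx (S3 t) *m B *m (invmx (S3 t) *m B)^T) by [].
rewrite /D mulNmx -(mulmxA (invmx _ *m _)) -/(riccati t) -(mulmxA (invmx _)).
rewrite -mulmxN -mulmxDr trmx_mul -[in RHS](mulmxA _ B) -[RHS]mulmxN.
congr (_ *m _); rewrite [in RHS]mulmxA -[RHS]mulmxN -invS.
rewrite mulmxDl -(mulmxA A) R3_riccati opprD addrACA addNr addr0.
by rewrite [RHS]mulmxBr [in RHS]mulmxA [LHS]addrC.
Qed.

End Invertible.

Lemma riccati_nincr s t : 0 < s -> s < t ->
  (forall u, s <= u <= t -> \det (S3 u) != 0) ->
  forall v, dotv v (riccati t *m v) <= dotv v (riccati s *m v).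
Proof.
move=> s0 st nd v.
pose q u := dotv v (riccati u *m v).
have dq u : s <= u <= t -> is_derive u 1 q
    (- dotv ((invmx (S3 u) *m B)^T *m v) ((invmx (S3 u) *m B)^T *m v)).
  move=> /nd ndu.
  have /(_ 0 0) := mderivMl v^T (mderivMr v (mderiv_riccati ndu)).
  set D := (X in is_derive _ _ _ X -> _).
  suff <- : D = - dotv ((invmx (S3 u) *m B)^T *m v) ((invmx (S3 u) *m B)^T *m v) by [].
  by rewrite -dotv_mulmx mulmxA /D mulNmx mulmxN mxE.
have nincr : {in `[s, t] &, {homo q : x y /~ x <= y}}.
  apply: ler0_derive1_le_cc.
  - move=> u; rewrite in_itv/= => /andP[su ut].
    by have [] := dq u; rewrite ?(ltW su) ?(ltW ut).
  - move=> u; rewrite in_itv/= => /andP[su ut].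
    have ust : s <= u <= t by rewrite (ltW su) (ltW ut).
    by have [_] := dq u ust; rewrite derive1E => ->; rewrite oppr_le0 dotv_ge0.
  - apply: derivable_within_continuous => u; rewrite in_itv/= => ust.
    by have [] := dq u ust.
by apply: nincr; rewrite ?in_itv/= ?lexx ?ltW.
Qed.

End HamiltonianFlow.

(** * Lebesgue integrals over a segment starting at 0 *)

Section IntervalIntegral.
Variable R : realType.
Implicit Types (f g : R -> R) (T : R).

Local Notation mu := (lebesgue_measure : measure _ R).
Local Notation Int t f := (Rintegral mu `[0, t] f).

Definition itv_integrable T f := mu.-integrable `[0, T] (EFin \o f).

Lemma itv_integrableD T f g :
  itv_integrable T f -> itv_integrable T g -> itv_integrable T (fun s => f s + g s).
Proof. by move=> fi gi; apply: (integrableD _ fi gi). Qed.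

Lemma itv_integrableZ T a f : itv_integrable T f -> itv_integrable T (fun s => a * f s).
Proof. by move=> fi; apply: (integrableZl _ a fi). Qed.

Lemma itv_integrable_sum (I : Type) (r : seq I) T (f : I -> R -> R) :
  (forall i, itv_integrable T (f i)) -> itv_integrable T (fun s => \sum_(i <- r) f i s).
Proof.
move=> fi; elim: r => [|i r IH].
  by under eq_fun do rewrite big_nil; exact: integrable0.
by under eq_fun do rewrite big_cons; exact: itv_integrableD.
Qed.

Lemma itv_integrable_within T f :
  {within `[0, T], continuous f} -> itv_integrable T f.
Proof.
by move=> cf; apply: continuous_compact_integrable => //; exact: segment_compact.
Qed.

Lemma itv_integrable_continuous T f : continuous f -> itv_integrable T f.
Proof. by move=> cf; apply: itv_integrable_within; exact: continuous_subspaceT. Qed.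

Lemma itv_integrable_le T t f : t <= T -> itv_integrable T f -> itv_integrable t f.
Proof.
move=> tT; apply: integrableS => //.
by apply: subset_itvl; rewrite bnd_simp.
Qed.

Lemma measurable_continuous_itv T f : continuous f -> measurable_fun `[0, T] f.
Proof.
move=> cf; apply: subspace_continuous_measurable_fun => //.
exact: continuous_subspaceT.
Qed.

Lemma itv_integrable_mul T f g :
  continuous f -> itv_integrable T g -> itv_integrable T (fun s => f s * g s).
Proof.
move=> cf gi; apply: (@integrableMr _ _ _ mu `[0, T] _ f (EFin \o g)) => //.
  exact: measurable_continuous_itv.
have /compact_bounded [M [Mr Mf]] : compact (f @` `[0, T]).
  by apply: continuous_compact; [exact: continuous_subspaceT|exact: segment_compact].
exists M; split => // x Mx y /= yT; exact: (Mf x Mx (f y) (imageP f yT)).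
Qed.

Lemma Int_sum (I : Type) (r : seq I) T (f : I -> R -> R) :
  (forall i, itv_integrable T (f i)) ->
  Int T (fun s => \sum_(i <- r) f i s) = \sum_(i <- r) Int T (f i).
Proof.
move=> fi; elim: r => [|i r IH].
  rewrite big_nil; under eq_Rintegral do rewrite big_nil.
  by rewrite Rintegral_cst// mul0r.
rewrite big_cons -IH; under eq_Rintegral do rewrite big_cons.
by rewrite RintegralD//; [exact: fi|exact: itv_integrable_sum].
Qed.

Lemma Int_lincomb T a b f g : itv_integrable T f -> itv_integrable T g ->
  a * Int T f + b * Int T g = Int T (fun s => a * f s + b * g s).
Proof.
move=> fi gi; rewrite RintegralD//; try exact: itv_integrableZ.
by rewrite !RintegralZl.
Qed.

Lemma Int_FTC t F f : 0 <= t -> continuous f ->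
  (forall s : R, is_derive s (1 : R) F (f s)) -> Int t f = F t - F 0.
Proof.
move=> + cf dF; rewrite le_eqVlt => /predU1P[<-|t0].
  by rewrite set_itv1 Rintegral_set1 subrr.
have cF : continuous F.
  by move=> s; have [dFs _] := dF s; exact/differentiable_continuous/derivable1_diffP.
rewrite /Rintegral (@continuous_FTC2 _ f F 0 t)//.
- exact: continuous_subspaceT.
- split.
  + by move=> s _; have [] := dF s.
  + by apply: cvg_at_right_filter; exact: cF.
  + by apply: cvg_at_left_filter; exact: cF.
- by move=> s _; rewrite derive1E; have [_ ->] := dF s.
Qed.

End IntervalIntegral.

(** * Controls, trajectories, the quadratic action and its extremals *)

Section Controls.
Variables (R : realType) (n m : nat).
Variables (A : 'M[R]_n) (B : 'M[R]_(n, m)) (Q : 'M[R]_n) (T : R).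
Hypothesis T_gt0 : 0 < T.
Implicit Types (u w : R -> 'cV[R]_m) (x d : 'cV[R]_n).

Local Notation mu := (lebesgue_measure : measure _ R).
Local Notation Int t f := (Rintegral mu `[0, t] f).
Local Notation E t := (mexp (t *: A)).

(** Square integrability on a bounded interval gives integrability through [|a| <= 1 + a^2]. *)
Lemma admissible_integrable u i : admissible T u -> itv_integrable T (fun s => u s i 0).
Proof.
move=> /(_ i)[mu_ ui].
apply: (@le_integrable _ _ _ mu `[0, T] _ _
  (EFin \o (fun s => 1 + u s i 0 ^+ 2))) => //.
- exact/measurable_EFinP.
- move=> s _; rewrite /= lee_fin [leRHS]ger0_norm ?addr_ge0 ?sqr_ge0//.
  have := sqr_ge0 (u s i 0 - 1); have := sqr_ge0 (u s i 0 + 1).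
  by rewrite ler_norml; nra.
- apply: itv_integrableD => //; apply: itv_integrable_continuous.
  by move=> ?; exact: cvg_cst.
Qed.

Lemma admissibleD u w a : admissible T u -> admissible T w ->
  admissible T (fun s => u s + a *: w s).
Proof.
move=> au aw i; have [mui ui] := au i; have [mwi wi] := aw i.
have msum : measurable_fun `[0, T] (fun s => u s i 0 + a * w s i 0).
  by apply: measurable_funD => //; apply: measurable_funM.
have uwE : (fun s => (u s + a *: w s) i 0) = (fun s => u s i 0 + a * w s i 0).
  by apply/funext => s; rewrite !mxE.
split; first by rewrite uwE.
rewrite (_ : (fun s => _) = EFin \o (fun s => (u s i 0 + a * w s i 0) ^+ 2)); last first.
  by apply/funext => s; rewrite !mxE.
apply: (@le_integrable _ _ _ mu `[0, T] _ _
  (EFin \o (fun s => 2 * u s i 0 ^+ 2 + 2 * a ^+ 2 * w s i 0 ^+ 2))) => //.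
- by apply/measurable_EFinP; exact: measurable_funX.
- move=> s _; rewrite /= lee_fin !ger0_norm ?sqr_ge0//; last first.
    have := mulr_ge0 (sqr_ge0 a) (sqr_ge0 (w s i 0)).
    by have := sqr_ge0 (u s i 0); lra.
  by have := sqr_ge0 (u s i 0 - a * w s i 0); nra.
- by apply: itv_integrableD; exact: itv_integrableZ.
Qed.

Lemma admissible_continuous w :
  (forall i, continuous (fun s => w s i 0)) -> admissible T w.
Proof.
move=> cw i; split; first exact: measurable_continuous_itv.
apply: itv_integrable_continuous => s.
by apply: cvgM; exact: cw.
Qed.

Lemma continuous_mexp_opp (t : R) i j : continuous (fun s : R => (E (t - s : R) *m B) i j).
Proof.
move=> s; have := mderiv_opp_arg (mderiv_shift (mderivMr B (mderiv_mexp A (- s + t)))).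
move=> /(mderiv_continuous (i := i) (j := j)).
suff -> : (fun s : R => (E (t - s : R) *m B) i j) =
  (fun s : R => (E (- s + t : R) *m B) i j) by [].
by apply/funext => r; rewrite addrC.
Qed.

(** The kernel time [t] and the endpoint [r] are kept apart because [trajE] moves the kernel time to
    0 while still integrating up to [t]. *)
Lemma traj_integrable u t r i : admissible T u -> r <= T ->
  itv_integrable r (fun s : R => (E (t - s : R) *m B *m u s) i 0).
Proof.
move=> au rT; under eq_fun do rewrite mxE.
apply: itv_integrable_sum => j; apply: itv_integrable_mul.
  exact: continuous_mexp_opp.
exact: itv_integrable_le (admissible_integrable _ au).
Qed.

Lemma trajD x d u w a t : admissible T u -> admissible T w -> t <= T ->
  traj A B (x + a *: d) (fun s => u s + a *: w s) t =
  traj A B x u t + a *: traj A B d w t.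
Proof.
move=> au aw tT; rewrite /traj scalerDr addrACA mulmxDr -scalemxAr.
congr (_ + _); apply/colP => i; rewrite !mxE.
rewrite -RintegralZl//; last exact: traj_integrable.
rewrite -RintegralD//; [|exact: traj_integrable|]; last first.
  by apply: itv_integrableZ; exact: traj_integrable.
by apply: eq_Rintegral => s _; rewrite mulmxDr -scalemxAr !mxE.
Qed.

(** Factoring out the exponential leaves an integral that depends on [t] only through its upper
    endpoint, which is what continuity of the trajectory requires. *)
Lemma trajE x u t : admissible T u -> t <= T -> traj A B x u t =
  E t *m (x + \col_i Int t (fun s : R => (E (0 - s : R) *m B *m u s) i 0)).
Proof.
move=> au tT; rewrite /traj mulmxDr; congr (_ + _); apply/colP => i.
rewrite [RHS]mxE.
have ti j : itv_integrable t (fun s : R => (E (0 - s : R) *m B *m u s) j 0).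
  exact: traj_integrable.
rewrite (eq_bigr (fun j => Int t (fun s => E t i j * (E (0 - s) *m B *m u s) j 0))).
  rewrite -(@Int_sum _ _ _ t (fun j s => E t i j * (E (0 - s) *m B *m u s) j 0)).
    rewrite mxE; apply: eq_Rintegral => s _.
    by rewrite -[t - s]/(t + - s) mexpD -!mulmxA mxE sub0r.
  by move=> j; exact: itv_integrableZ.
by move=> j _; rewrite mxE; apply/esym/RintegralZl => //; exact: ti.
Qed.

Lemma traj_continuous x u i : admissible T u ->
  {within `[0, T], continuous (fun t => traj A B x u t i 0)}.
Proof.
move=> au.
apply: (@subspace_eq_continuous _ _ _ (fun t : R => \sum_j E t i j *
    (x j 0 + Int t (fun s : R => (E (0 - s : R) *m B *m u s) j 0)))) => [t|].
  rewrite inE/= in_itv/= => /andP[_ tT].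
  rewrite -[RHS]/(traj A B x u t i 0) trajE// mxE.
  by apply: eq_bigr => j _; rewrite !mxE.
move=> t; apply: cvg_sum => j; apply: cvgM.
  apply: continuous_subspaceT => {}t.
  exact: mderiv_continuous (mderiv_mexp A t).
apply: cvgD; first exact: cvg_cst.
apply: (@parameterized_integral_continuous R 0 T); first exact: ltW.
exact: traj_integrable.
Qed.

Definition lq_lagrangian x u s :=
  enorm (u s) ^+ 2 - dotv (traj A B x u s) (Q *m traj A B x u s).

Lemma lq_lagrangian_integrable x u : admissible T u ->
  itv_integrable T (lq_lagrangian x u).
Proof.
move=> au.
have -> : lq_lagrangian x u = (fun s => \sum_i u s i 0 ^+ 2 + (-1) *
    \sum_i traj A B x u s i 0 * \sum_j Q i j * traj A B x u s j 0).
  apply/funext => s; rewrite /lq_lagrangian enorm_sqr !dotvE mulN1r.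
  congr (_ - _); apply: eq_bigr => i _.
  by rewrite [X in _ * X]mxE.
apply: itv_integrableD; first by apply: itv_integrable_sum => i; have [] := au i.
apply: itv_integrableZ; apply: itv_integrable_within.
move=> t; apply: cvg_sum => i; apply: cvgM; first exact: traj_continuous.
by apply: cvg_sum => j; apply: cvgM; [exact: cvg_cst|exact: traj_continuous].
Qed.

(* The action is a quadratic functional of the pair (initial point, control). *)
Lemma lq_action_convex_comb x d u w t : admissible T u -> admissible T w ->
  (1 - t) * lq_action A B Q T (x - t *: d) (fun s => u s - t *: w s) +
  t * lq_action A B Q T (x + (1 - t) *: d) (fun s => u s + (1 - t) *: w s) =
  lq_action A B Q T x u + t * (1 - t) * lq_action A B Q T d w.
Proof.
move=> au aw; rewrite -!scaleNr; under [X in lq_action _ _ _ _ _ X]eq_fun do rewrite -scaleNr.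
have au1 := admissibleD (- t) au aw; have au2 := admissibleD (1 - t) au aw.
have half (a b c e : R) : (1 - t) * a + t * b = c + t * (1 - t) * e ->
    (1 - t) * (2^-1 * a) + t * (2^-1 * b) = 2^-1 * c + t * (1 - t) * (2^-1 * e).
  by move=> h; rewrite mulrCA [t * _]mulrCA -mulrDr h; ring.
apply: half.
rewrite -[LHS]/((1 - t) * Int T (lq_lagrangian (x + - t *: d) (fun s => u s + - t *: w s))
  + t * Int T (lq_lagrangian (x + (1 - t) *: d) (fun s => u s + (1 - t) *: w s))).
rewrite -[RHS]/(Int T (lq_lagrangian x u) + t * (1 - t) * Int T (lq_lagrangian d w)).
have i1 := lq_lagrangian_integrable (x + - t *: d) au1.
have i2 := lq_lagrangian_integrable (x + (1 - t) *: d) au2.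
have i3 := lq_lagrangian_integrable x au.
have i4 := lq_lagrangian_integrable d aw.
rewrite (Int_lincomb _ _ i1 i2) -[X in _ = X + _]mul1r (Int_lincomb _ _ i3 i4).
(* Pointwise this is the identity for a quadratic form at [X - t Y] and [X + (1 - t) Y]: the cross
   terms carry the opposite weights [- t (1 - t)] and [t (1 - t)]. *)
apply: eq_Rintegral => s; rewrite inE/= in_itv/= => /andP[_ sT].
rewrite /lq_lagrangian !enorm_sqr !trajD//.
move: (traj A B x u s) (traj A B d w s) (u s) (w s) => X Y U W.
rewrite !(mulmxDr, dotvDl, dotvDr) -!scalemxAr !(dotvZl, dotvZr).
by rewrite (dotvC W U); ring.
Qed.

Section Extremal.
Variables p0 x0 : 'cV[R]_n.

Local Notation pt t := (R1 A B Q t *m p0 + R2 A B Q t *m x0).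
Local Notation xt t := (R3 A B Q t *m p0 + R4 A B Q t *m x0).

(** The Pontryagin control: [pt] is the covector and [xt] the state of the Hamiltonian trajectory
    issued from [(p0, x0)]. *)
Definition extremal_control t : 'cV[R]_m := B^T *m pt t.

Lemma mderiv_extremal_covector t :
  mderiv (fun s => pt s) t (- (A^T *m pt t) - Q *m xt t).
Proof.
have := mderivD (mderivMr p0 (mderiv_R1 A B Q t)) (mderivMr x0 (mderiv_R2 A B Q t)).
rewrite !mulmxBl !mulNmx !mulmxDr !mulmxA addrACA.
by rewrite -[in X in mderiv _ _ X]opprD -[in X in mderiv _ _ X]opprD.
Qed.

Lemma mderiv_extremal t :
  mderiv (fun s => xt s) t (A *m xt t + B *m extremal_control t).
Proof.
have := mderivD (mderivMr p0 (mderiv_R3 A B Q t)) (mderivMr x0 (mderiv_R4 A B Q t)).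
by rewrite /extremal_control !mulmxDl !mulmxDr !mulmxA addrACA addrC.
Qed.

Lemma extremal_control_continuous i : continuous (fun s => extremal_control s i 0).
Proof.
move=> s.
exact: (mderiv_continuous (mderivMl B^T (mderiv_extremal_covector s))).
Qed.

Lemma extremal_admissible : admissible T extremal_control.
Proof. exact: admissible_continuous extremal_control_continuous. Qed.

Lemma continuous_extremal i : continuous (fun s => xt s i 0).
Proof. by move=> s; exact: (mderiv_continuous (mderiv_extremal s)). Qed.

(** The integrand of the variation of constants formula is the derivative in [s] of
    [E (t - s) *m xt s]. *)
Lemma extremal_traj (t : R) : 0 <= t -> traj A B x0 extremal_control t = xt t.
Proof.
move=> t0; apply/colP => i; rewrite [LHS]mxE [X in _ + X]mxE.
have cf : continuous (fun s : R => (E (t - s : R) *m B *m extremal_control s) i 0).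
  move=> s; rewrite (_ : (fun _ => _) =
    (fun s : R => \sum_j (E (t - s : R) *m B) i j * extremal_control s j 0)).
    apply: cvg_sum => j; apply: cvgM; first exact: continuous_mexp_opp.
    exact: extremal_control_continuous.
  by apply/funext => r; rewrite mxE.
have dF (s : R) : is_derive s (1 : R) (fun s : R => (E (- s + t : R) *m xt s) i 0)
    ((E (t - s : R) *m B *m extremal_control s) i 0).
  have := mderivM (mderiv_opp_arg (mderiv_shift (mderiv_mexp A (- s + t))))
    (mderiv_extremal s).
  move=> /(_ i 0); rewrite mexp_comm mulNmx mulmxDr !mulmxA addrA addNr add0r.
  by rewrite (addrC (- s)).
rewrite (Int_FTC t0 cf dF) addNr mexp0 mul1mx oppr0 add0r R3_0 R4_0.
by rewrite mul0mx mul1mx add0r addrC subrK.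
Qed.

(** Along an extremal the Lagrangian is exact: it is the derivative of the pairing [pt . xt], so
    only boundary terms remain. *)
Lemma extremal_action : lq_action A B Q T x0 extremal_control =
  2^-1 * (dotv (pt T) (xt T) - dotv p0 x0).
Proof.
rewrite /lq_action; congr (_ * _).
pose q s := enorm (extremal_control s) ^+ 2 - dotv (xt s) (Q *m xt s).
rewrite -[LHS]/(Int T (lq_lagrangian x0 extremal_control)).
have -> : Int T (lq_lagrangian x0 extremal_control) = Int T q.
  apply: eq_Rintegral => s; rewrite inE/= in_itv/= => /andP[s0 _].
  by rewrite /lq_lagrangian extremal_traj.
have dq (s : R) : is_derive s (1 : R) (fun s => dotv (pt s) (xt s)) (q s).
  have := mderivM (mderiv_tr (mderiv_extremal_covector s)) (mderiv_extremal s).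
  move=> /(_ 0 0).
  suff -> : ((- (A^T *m pt s) - Q *m xt s)^T *m xt s +
      (pt s)^T *m (A *m xt s + B *m extremal_control s)) 0 0 = q s by [].
  rewrite [LHS]mxE -!/(dotv _ _) /q /extremal_control.
  move: (R1 A B Q s *m p0 + _) (R3 A B Q s *m p0 + _) => P X.
  rewrite !dotvDl dotvDr !dotvNl (dotv_mulmx A) (dotv_mulmx B) enorm_sqr.
  rewrite (dotvC (Q *m X)).
  by ring.
have cq : continuous q.
  move=> s; rewrite (_ : q = (fun s => \sum_i extremal_control s i 0 * extremal_control s i 0
      - \sum_i xt s i 0 * \sum_j Q i j * xt s j 0)); last first.
    apply/funext => r; rewrite /q enorm_sqr !dotvE; congr (_ - _).
    by apply: eq_bigr => i _; rewrite [X in _ * X]mxE.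
  apply: cvgB; apply: cvg_sum => i; apply: cvgM; try exact: extremal_control_continuous.
    exact: continuous_extremal.
  by apply: cvg_sum => j; apply: cvgM; [exact: cvg_cst|exact: continuous_extremal].
rewrite (Int_FTC (ltW T_gt0) cq dq).
rewrite R3_0 R4_0 mul0mx mul1mx add0r /R1 /R2 flow0 (scalar_mx_block n n 1).
by rewrite block_mxKul block_mxKur mul0mx mul1mx addr0.
Qed.

End Extremal.

End Controls.

(** * Semiconvexity of c-convex potentials, with the sharp matrix [K T] *)

Section Semiconvexity.
Variables (R : realType) (n m : nat).
Variables (A : 'M[R]_n) (B : 'M[R]_(n, m)) (Q : 'M[R]_n) (T : R).
Hypotheses (T_gt0 : 0 < T) (Qsym : Q^T = Q) (R3T : \det (R3 A B Q T) != 0).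
Implicit Types (z d y : 'cV[R]_n) (t : R).

Local Notation K := (riccati A B Q T).

Lemma steering_control d : exists w : R -> 'cV[R]_m,
  [/\ admissible T w, traj A B d w T = 0 &
      lq_action A B Q T d w = 2^-1 * dotv d (K *m d)].
Proof.
pose p0 := - (K *m d).
have xT : R3 A B Q T *m p0 + R4 A B Q T *m d = 0.
  by rewrite mulmxN mulmxA R3_riccati// addNr.
exists (extremal_control A B Q p0 d); split.
- exact: extremal_admissible.
- by rewrite extremal_traj ?ltW.
- by rewrite extremal_action// xT dotv0r sub0r /p0 dotvNl opprK dotvC.
Qed.

(* Adding multiples of the control steering [d] to [0] to a control for [z]
   yields competitors for [z - t d] and [z + (1 - t) d] with the same endpoint. *)
Lemma lq_cost_semiconcave t z d y (u : R -> 'cV[R]_m) : 0 <= t <= 1 ->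
  admissible T u -> traj A B z u T = y ->
  exists J1 J2 : R,
    [/\ (lq_cost A B Q T (z - t *: d) y <= J1%:E)%E,
        (lq_cost A B Q T (z + (1 - t) *: d) y <= J2%:E)%E &
        (1 - t) * J1 + t * J2 =
        lq_action A B Q T z u + t * (1 - t) * (2^-1 * dotv d (K *m d))].
Proof.
move=> t01 au uy; have [w [aw wT Jw]] := steering_control d.
have steer a : (lq_cost A B Q T (z + a *: d) y <=
    (lq_action A B Q T (z + a *: d) (fun s => u s + a *: w s))%:E)%E.
  apply: ereal_inf_lbound; exists (fun s => u s + a *: w s) => //.
  split; first exact: admissibleD.
  by rewrite (@trajD R n m A B T z d u w a T au aw (lexx T)) wT scaler0 addr0.
exists (lq_action A B Q T (z - t *: d) (fun s => u s - t *: w s)).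
exists (lq_action A B Q T (z + (1 - t) *: d) (fun s => u s + (1 - t) *: w s)).
split; [|exact: steer|by rewrite -Jw lq_action_convex_comb].
rewrite -scaleNr; under eq_fun do rewrite -scaleNr.
exact: steer.
Qed.

Lemma c_convex_semiconvex psi t z d (a b : R) :
  c_convex (lq_cost A B Q T) psi -> 0 <= t <= 1 ->
  psi (z - t *: d) = a%:E -> psi (z + (1 - t) *: d) = b%:E ->
  (psi z <= ((1 - t) * a + t * b + t * (1 - t) * (2^-1 * dotv d (K *m d)))%:E)%E.
Proof.
move=> [_ [zeta psiE]] t01 psi1 psi2.
have ub x v y : psi x = v%:E -> (zeta y - lq_cost A B Q T x y <= v%:E)%E.
  by move=> <-; rewrite psiE; apply: ereal_sup_ubound; exists y.
rewrite psiE; apply: ge_ereal_sup => _ [y _ <-].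
have {}ub1 := ub _ _ y psi1; have {}ub2 := ub _ _ y psi2.
case: (zeta y) ub1 ub2 => [r||] ub1 ub2; last by rewrite addNye leNye.
- have sub_le (v J : R) c : (r%:E - c <= v%:E)%E -> (c <= J%:E)%E -> r - J <= v.
    case: c => [c||]//=; rewrite -?EFinB ?lee_fin => *; lra.
  set M := (1 - t) * a + _ + _.
  suff : ((r - M)%:E <= lq_cost A B Q T z y)%E.
    case: (lq_cost A B Q T z y) => [c||]; last by rewrite leeNy_eq.
      by rewrite -EFinB !lee_fin => ?; lra.
    by rewrite /= leNye.
  (* The infimum at [z] is bounded below control by control, each one yielding its own pair of
     competitors. *)
  apply: le_ereal_inf_tmp => _ [u [au uy] <-].
  rewrite lee_fin /M; have [J1 [J2 [c1 c2]]] := @lq_cost_semiconcave t z d y u t01 au uy.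
  have := sub_le _ _ _ ub1 c1; have := sub_le _ _ _ ub2 c2.
  move/andP: t01 => [t0 t1] h2 h1.
  have := ler_wpM2l t0 h2; have := @ler_wpM2l _ (1 - t) _ _ _ h1.
  by rewrite subr_ge0 => /(_ t1); nra.
(* Case [zeta y = +oo]: an infinite cost at [z] contributes [-oo] by the convention for [+oo - +oo].
   Otherwise some control reaches [y], the cost at [z - t *: d] is bounded above, and [psi] would be
   [+oo] there. *)
- have [->|noty] := eqVneq (lq_cost A B Q T z y) +oo%E; first by rewrite addeNy leNye.
  have [u [au uy]] : exists u, admissible T u /\ traj A B z u T = y.
    apply: contrapT => nou; case/eqP: noty; rewrite /lq_cost.
    rewrite (_ : [set _ | _ in _] = set0) ?ereal_inf0//.
    by apply/seteqP; split=> // J [u uP _]; apply: nou; exists u.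
  have [J1 [_ [c1 _ _]]] := @lq_cost_semiconcave t z d y u t01 au uy.
  by move: ub1 c1; case: (lq_cost A B Q T (z - t *: d) y).
Qed.

End Semiconvexity.

(** * Gradients of a semiconvex function near a point with a second order expansion *)

Section SemiconvexDifferentiability.
Variables (R : realType) (n : nat).
Implicit Types (u v h y z : 'cV[R]_n) (M : 'M[R]_n).

Lemma le_of_eps (a b c : R) : 0 <= c ->
  (forall eps, 0 < eps -> a <= b + eps * c) -> a <= b.
Proof.
move=> c0 h; rewrite leNgt; apply/negP => ba.
have := h ((a - b) / (2 * (c + 1))); rewrite divr_gt0 ?subr_gt0//; last by lra.
move=> /(_ isT); have -> : (a - b) / (2 * (c + 1)) * c = (a - b) / 2 * (c / (c + 1)).
  by field; lra.
have c1 : c / (c + 1) <= 1 by rewrite ler_pdivrMr; lra.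
by nra.
Qed.

Lemma quad_form_bound M : exists2 c : R, 0 < c &
  forall v, `|dotv v (M *m v)| <= c * enorm v ^+ 2.
Proof.
have [c c0 cM] := enorm_mulmx M; exists c => // v.
rewrite (le_trans (dotv_le _ _))// expr2 mulrCA ler_wpM2l ?enorm_ge0//.
Qed.

Lemma enorm_box v (r : R) : 0 <= r -> (forall i, `|v i 0| <= r) ->
  enorm v <= n%:R * r.
Proof.
move=> r0 vr; rewrite -(@ler_pXn2r _ 2)// ?nnegrE ?mulr_ge0 ?enorm_ge0//.
rewrite enorm_sqr dotvE exprMn (@le_trans _ _ (\sum_(i < n) r ^+ 2))//.
  apply: ler_sum => i _; rewrite -expr2 -[leLHS]real_normK ?num_real//.
  by rewrite lerXn2r// nnegrE.
rewrite sumr_const card_ord -[leLHS]mulr_natl ler_wpM2r ?sqr_ge0//.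
by rewrite -natrX ler_nat; case: n => // k; rewrite leq_pmulr.
Qed.

Lemma has_grad_unique (psi : 'cV[R]_n -> \bar R) x g1 g2 :
  has_grad psi x g1 -> has_grad psi x g2 -> g1 = g2.
Proof.
move=> [_ h1] [_ h2]; apply/eqP; rewrite -subr_eq0; apply/eqP/enorm_eq0.
set w := g1 - g2; apply/eqP; rewrite eq_le enorm_ge0 andbT.
have [-> |w0] := eqVneq w 0; first by rewrite enorm0.
have nw : 0 < enorm w.
  by rewrite lt_neqAle enorm_ge0 andbT eq_sym; apply: contra_neq w0; exact: enorm_eq0.
apply: (@le_of_eps _ _ 2) => // eps eps0; rewrite add0r.
have [d1 d1_0 D1] := h1 _ eps0; have [d2 d2_0 D2] := h2 _ eps0.
pose s : R := Num.min d1 d2 / (2 * enorm w).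
have s0 : 0 < s by rewrite divr_gt0 ?lt_min ?d1_0// mulr_gt0.
have sw : enorm (s *: w) = Num.min d1 d2 / 2.
  by rewrite enormZ gtr0_norm// /s; field; rewrite gt_eqF.
have m0 : 0 < Num.min d1 d2 by rewrite lt_min d1_0.
have [|_] := D1 (s *: w).
  by rewrite sw (@lt_le_trans _ _ (Num.min d1 d2)) ?ge_min ?lexx//; lra.
have [|_] := D2 (s *: w).
  by rewrite sw (@lt_le_trans _ _ (Num.min d1 d2)) ?ge_min ?lexx ?orbT//; lra.
rewrite !ler_norml => /andP[a1 a2] /andP[b1 b2].
have : dotv g1 (s *: w) - dotv g2 (s *: w) = s * enorm w ^+ 2.
  by rewrite -dotvNl -dotvDl dotvZr enorm_sqr.
have := sw; rewrite enormZ gtr0_norm// => {}sw.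
move=> e; have : s * enorm w ^+ 2 <= 2 * eps * (s * enorm w).
  by rewrite -e; rewrite enormZ gtr0_norm// in a1 a2 b1 b2; lra.
have sw0 : 0 < s * enorm w by rewrite mulr_gt0.
move=> H; have : s * enorm w * enorm w <= s * enorm w * (2 * eps) by lra.
by rewrite (ler_pM2l sw0) mulrC.
Qed.

Variables (psi : 'cV[R]_n -> \bar R) (x g : 'cV[R]_n) (P K : 'M[R]_n) (r0 : R).
Local Notation f := (fun y => fine (psi y)).
Hypothesis Psym : P^T = P.
Hypothesis r0_gt0 : 0 < r0.
Hypothesis psi_fin : forall y, enorm (y - x) < r0 -> psi y \is a fin_num.
Hypothesis semiconvex : forall (t : R) y h, 0 <= t <= 1 ->
  enorm (y - x) < r0 -> enorm (y + h - x) < r0 ->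
  f (y + t *: h) <= (1 - t) * f y + t * f (y + h)
                    + t * (1 - t) * (2^-1 * dotv h (K *m h)).
Hypothesis taylor : forall eps : R, 0 < eps -> exists2 d : R, 0 < d & forall v,
  enorm v < d ->
  `| f (x + v) - f x - dotv g v - 2^-1 * dotv (P *m v) v | <= eps * enorm v ^+ 2.

Lemma semiconvex_mid y h : enorm (y + h - x) < r0 -> enorm (y - h - x) < r0 ->
  f y <= 2^-1 * f (y + h) + 2^-1 * f (y - h) + 2^-1 * dotv h (K *m h).
Proof.
move=> h1 h2.
have := @semiconvex 2^-1 (y - h) (2 *: h).
rewrite (_ : y - h + 2 *: h = y + h); last by rewrite scaler_nat mulr2n addrA subrK.
rewrite scalerA mulVf ?pnatr_eq0// scale1r subrK -scalemxAr dotvZl dotvZr.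
move=> /(_ _ h2 h1); rewrite invr_ge0 ler0n invf_le1// ler1n => /(_ isT) H.
by apply: (le_trans H); lra.
Qed.

(** Midpoint semiconvexity at [x] between [x + s *: v] and [x - s *: v]: the first order terms
    cancel, and one divides by [s ^+ 2]. *)
Lemma hessian_semiconvex v : 0 <= dotv v ((P + K) *m v).
Proof.
rewrite -[X in _ <= X]addr0 -[X in 0 <= X]/(_ + 0).
apply: (@le_of_eps 0 _ (2 * enorm v ^+ 2)); first by rewrite mulr_ge0 ?sqr_ge0.
move=> eps eps0; have [d d0 D] := taylor eps0.
have nv1 : 0 < enorm v + 1 by rewrite ltr_wpDl ?enorm_ge0.
pose s := Num.min d r0 / (2 * (enorm v + 1)).
have m0 : 0 < Num.min d r0 by rewrite lt_min d0.
have s0 : 0 < s by rewrite divr_gt0// mulr_gt0.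
have sv : enorm (s *: v) < Num.min d r0.
  rewrite enormZ gtr0_norm// /s mulrAC ltr_pdivrMr ?mulr_gt0//.
  by rewrite ltr_pM2l//; have := enorm_ge0 v; lra.
move: sv; rewrite lt_min => /andP[svd svr].
have svd' : enorm (- (s *: v)) < d by rewrite enormN.
have := @semiconvex_mid x (s *: v); rewrite addrAC subrr add0r addrAC subrr add0r.
rewrite enormN => /(_ svr svr).
have := D _ svd; have := D _ svd'; rewrite !ler_norml => /andP[_ b] /andP[_ a].
move: a b; rewrite enormN mulmxN dotvNr dotvNl dotvNr opprK enormZ gtr0_norm//.
rewrite -!scalemxAr !dotvZl !dotvZr mulmxDl dotvDr (dotvC v (P *m v)) exprMn.
set p := dotv (P *m v) v; set k := dotv v (K *m v); set N := enorm v ^+ 2.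
move=> a b c; have s2 : 0 < s ^+ 2 by rewrite exprn_gt0.
rewrite -(ler_pM2l s2) mulr0.
by rewrite addr0; nra.
Qed.

(** Semiconvexity at [y + t *: h], divided by [t] as [t] tends to 0; the weight [t * (1 - t)]
    becomes 1, so the full half of the [K] form remains. *)
Lemma grad_semiconvex_le y gy h : has_grad psi y gy ->
  enorm (y - x) < r0 -> enorm (y + h - x) < r0 ->
  dotv gy h <= f (y + h) - f y + 2^-1 * dotv h (K *m h).
Proof.
move=> [_ gyP] yr yhr.
apply: (@le_of_eps _ _ (enorm h + `|dotv h (K *m h)|)).
  by rewrite addr_ge0 ?enorm_ge0.
move=> eps eps0; have [d d0 D] := gyP _ eps0.
have nh1 : 0 < enorm h + 1 by rewrite ltr_wpDl ?enorm_ge0.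
(* The bound by [eps] absorbs the term of order [t] left after division; the last bound keeps
   [t *: h] within [d]. *)
pose t := Num.min (Num.min 1 eps) (d / (enorm h + 1)).
have t0 : 0 < t by rewrite !lt_min ltr01 eps0 divr_gt0.
have t1 : t <= 1 by rewrite !ge_min lexx.
have te : t <= eps by rewrite !ge_min lexx orbT.
have td : enorm (t *: h) < d.
  have : t <= d / (enorm h + 1) by rewrite ge_min lexx orbT.
  rewrite ler_pdivlMr// enormZ gtr0_norm//; have := enorm_ge0 h; nra.
have [_] := D _ td; rewrite ler_norml => /andP[+ _].
rewrite enormZ gtr0_norm// dotvZr => a.
have := @semiconvex t y h; rewrite (ltW t0) t1 => /(_ isT yr yhr) b.
rewrite -(ler_pM2l t0).
set q := dotv h (K *m h) in b *; have := ler_norm (- q); rewrite normrN => q1.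
have q2 : - (t * q) <= eps * (2 * `|q|).
  have := ler_wpM2l (ltW t0) q1; have := normr_ge0 q; nra.
have : t * (- (t * q)) <= t * (eps * (2 * `|q|)) by rewrite ler_wpM2l// ltW.
lra.
Qed.

(** The gradient inequality at [y] is tested on an [h] parallel to the error [w], of length [al]
    times [|y - x|]. Expanding [f] at [y] and [y + h] gives [|h| |w| <= 5 e |v|^2 + c |h|^2 / 2],
    with [v = y - x]. *)
Lemma grad_differentiable eps : 0 < eps -> exists2 d : R, 0 < d &
  forall y gy, has_grad psi y gy -> has_grad psi x g -> enorm (y - x) < d ->
  enorm (gy - g - P *m (y - x)) <= eps * enorm (y - x).
Proof.
move=> eps0.
have [c1 c1_0 c1P] := quad_form_bound P; have [c2 c2_0 c2K] := quad_form_bound K.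
pose c := c1 + c2; have c0 : 0 < c by rewrite addr_gt0.
(* Since [|v + h| <= 2 |v|], the two Taylor errors total [5 e |v|^2]. The choice of [e] below turns
   them into [eps / 2] after division by [al], and this [al] makes the quadratic term at most
   [eps / 4]. *)
pose al := Num.min 1 (eps / (2 * c)).
have al0 : 0 < al by rewrite lt_min ltr01 divr_gt0// mulr_gt0.
have al1 : al <= 1 by rewrite ge_min lexx.
have alc : al * c <= eps / 2.
  have : al <= eps / (2 * c) by rewrite ge_min lexx orbT.
  rewrite -(ler_pM2r c0) => /le_trans -> //.
  by rewrite le_eqVlt; apply/orP; left; apply/eqP; field; rewrite gt_eqF.
pose e := al * eps / 10.
have e0 : 0 < e by rewrite divr_gt0// mulr_gt0.
have [d d0 D] := taylor e0.
exists (Num.min d r0 / 2); first by rewrite divr_gt0// lt_min d0.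
move=> y gy gyP gP; set v := y - x; set w := gy - g - P *m v => vd.
have yE : y = x + v by rewrite /v addrC subrK.
have gyE : gy = w + g + P *m v by rewrite /w addrAC !subrK.
clearbody v w; have [v0|v0] := eqVneq v 0.
  have gE : gy = g by apply: has_grad_unique gP; rewrite -[x]addr0 -v0 -yE.
  suff -> : w = 0 by rewrite enorm0 mulr_ge0 ?enorm_ge0// ltW.
  move: gyE; rewrite v0 mulmx0 addr0 gE -[LHS]add0r => /addIr.
  by [].
have nv : 0 < enorm v.
  by rewrite lt_neqAle enorm_ge0 andbT eq_sym; apply: contra_neq v0; exact: enorm_eq0.
have [w0|w0] := eqVneq w 0; first by rewrite w0 enorm0 mulr_ge0 ?enorm_ge0// ltW.
have nw : 0 < enorm w.
  by rewrite lt_neqAle enorm_ge0 andbT eq_sym; apply: contra_neq w0; exact: enorm_eq0.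
have [h nh wh] : exists2 h, enorm h = al * enorm v &
    dotv w h = al * enorm v * enorm w.
  exists ((al * enorm v / enorm w) *: w).
    rewrite enormZ ger0_norm ?divfK ?gt_eqF//.
    by rewrite divr_ge0 ?mulr_ge0 ?enorm_ge0// ltW.
  by rewrite dotvZr -enorm_sqr; field; rewrite gt_eqF.
have nvh : enorm (v + h) <= 2 * enorm v.
  rewrite (le_trans (enormD _ _))// nh; have := enorm_ge0 v; nra.
have vr : enorm v < d /\ enorm v < r0 /\ enorm (v + h) < d /\ enorm (v + h) < r0.
  have : 2 * enorm v < Num.min d r0 by move: vd; rewrite ltr_pdivlMr// mulrC.
  rewrite lt_min => /andP[? ?]; have := enorm_ge0 v => ?.
  by repeat split; lra.
case: vr => vd1 [vr1 [vd2 vr2]].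
have yhE : y + h - x = v + h by rewrite yE addrAC [x + v]addrC addrK.
have sub : dotv gy h <= f (y + h) - f y + 2^-1 * dotv h (K *m h).
  by apply: (grad_semiconvex_le gyP); rewrite ?yhE// yE addrAC subrr add0r.
have := D _ vd1; have := D _ vd2; rewrite addrA -yE !ler_norml.
move=> /andP[_ b] /andP[a _].
have vh2 : enorm (v + h) ^+ 2 <= 4 * enorm v ^+ 2.
  have -> : 4 * enorm v ^+ 2 = (2 * enorm v) ^+ 2 by ring.
  by rewrite lerXn2r// nnegrE ?mulr_ge0 ?enorm_ge0.
have hP := le_trans (ler_norm _) (c1P h); have hK := le_trans (ler_norm _) (c2K h).
have {}gyE : dotv gy h = dotv w h + dotv g h + dotv (P *m v) h.
  by rewrite -!dotvDl gyE.
have Phv : dotv (P *m h) v = dotv (P *m v) h.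
  by rewrite dotvC dotv_mulmx Psym.
move: b hP; rewrite mulmxDr !(dotvDl, dotvDr) Phv (dotvC h (P *m h)) => b hP.
have key : al * enorm v * enorm w <= 5 * e * enorm v ^+ 2 + 2^-1 * (c * enorm h ^+ 2).
  have := ler_wpM2l (ltW e0) vh2.
  move: wh gyE sub a b hP hK; rewrite /c.
  move: (enorm v ^+ 2) (enorm h ^+ 2) (enorm (v + h) ^+ 2) => N1 N2 N3.
  by move=> *; lra.
have av : 0 < al * enorm v by rewrite mulr_gt0.
rewrite -(ler_pM2l av) (le_trans key)//.
have -> : 5 * e * enorm v ^+ 2 = al * enorm v * (eps / 2 * enorm v).
  by rewrite /e; field.
have -> : 2^-1 * (c * enorm h ^+ 2) = al * enorm v * (2^-1 * (al * c) * enorm v).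
  by rewrite nh; ring.
rewrite -mulrDr ler_pM2l// -mulrDl ler_pM2r//; lra.
Qed.

Variable C M : R.
Hypotheses (C_gt0 : 0 < C) (M_gt0 : 0 < M).
Hypothesis K_le : forall v, `|dotv v (K *m v)| <= C * enorm v ^+ 2.
Hypothesis f_bounded : forall y, enorm (y - x) < r0 -> `|f y| <= M.

(** Stretch [h] to a vector [d] of length [rho]: semiconvexity bounds the increment along [h] by the
    fraction [|h| / rho] of the oscillation [2 * M] plus the semiconvexity defect. *)
Lemma semiconvex_lipschitz_le z h (rho : R) : 0 < rho ->
  enorm (z - x) + rho < r0 -> enorm h <= rho ->
  f (z + h) - f z <= (2 * M + C * rho ^+ 2) / rho * enorm h.
Proof.
move=> rho0 zr hrho.
have [->|h0] := eqVneq h 0; first by rewrite addr0 subrr enorm0 mulr0.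
have nh : 0 < enorm h.
  by rewrite lt_neqAle enorm_ge0 andbT eq_sym; apply: contra_neq h0; exact: enorm_eq0.
pose t := enorm h / rho; pose d := t^-1 *: h.
have t0 : 0 < t by rewrite divr_gt0.
have t1 : t <= 1 by rewrite ler_pdivrMr// mul1r.
have td : t *: d = h by rewrite scalerA mulfV ?scale1r// gt_eqF.
have nd : enorm d = rho.
  rewrite enormZ gtr0_norm ?invr_gt0// /t invfM invrK; field; rewrite gt_eqF//.
have zx : enorm (z - x) < r0 by lra.
have zdx : enorm (z + d - x) < r0.
  by rewrite addrAC (le_lt_trans (enormD _ _))// nd.
have := @semiconvex t z d; rewrite (ltW t0) t1 td => /(_ isT zx zdx) H.
have := f_bounded zx; have := f_bounded zdx; rewrite !ler_norml.
move=> /andP[_ b1] /andP[b2 _].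
have := le_trans (ler_norm _) (K_le d); rewrite nd => kd.
have -> : (2 * M + C * rho ^+ 2) / rho * enorm h = t * (2 * M + C * rho ^+ 2).
  by rewrite /t; field; rewrite gt_eqF.
have tt : 0 <= t * (1 - t) by rewrite mulr_ge0 ?subr_ge0// ltW.
have Cr : 0 < C * rho ^+ 2 by rewrite mulr_gt0// exprn_gt0.
have : t * (1 - t) * (2^-1 * dotv d (K *m d)) <= t * (C * rho ^+ 2).
  apply: (@le_trans _ _ (t * (1 - t) * (2^-1 * (C * rho ^+ 2)))).
    by rewrite ler_wpM2l// ler_wpM2l.
  by rewrite -mulrA ler_pM2l//; nra.
have : t * (fine (psi (z + d)) - fine (psi z)) <= t * (2 * M).
  by rewrite ler_pM2l//; lra.
lra.
Qed.

Lemma semiconvex_lipschitz z h (rho : R) : 0 < rho ->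
  enorm (z - x) + 2 * rho < r0 -> enorm h <= rho ->
  `|f (z + h) - f z| <= (2 * M + C * rho ^+ 2) / rho * enorm h.
Proof.
move=> rho0 zr hrho; rewrite ler_norml semiconvex_lipschitz_le//; last by lra.
rewrite andbT lerNl opprB -[in leRHS]enormN.
rewrite -{1}[z](addrK h); apply: semiconvex_lipschitz_le => //; last by rewrite enormN.
have := enormD (z - x) h; rewrite addrAC => ?; lra.
Qed.

(* A maximum point of [f - k |. - z|^2] is touched from above by a paraboloid
   and, by semiconvexity, from below by another one with the same gradient. *)
Lemma has_grad_touching y l (k rho : R) : 0 < rho -> 0 < k ->
  enorm (y - x) + rho < r0 ->
  (forall h, enorm h < rho -> f (y + h) <= f y + dotv l h + k * enorm h ^+ 2) ->
  has_grad psi y l.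
Proof.
move=> rho0 k0 yr touch.
have inb h : enorm h < rho -> enorm (y + h - x) < r0.
  by move=> hr; rewrite addrAC (le_lt_trans (enormD _ _))//; lra.
split; first by apply: psi_fin; lra.
move=> eps eps0.
have kC : 0 < k + C by rewrite addr_gt0.
exists (Num.min rho (eps / (k + C))); first by rewrite lt_min rho0 divr_gt0.
move=> h; rewrite lt_min => /andP[hr he]; split; first exact/psi_fin/inb.
have hr' : enorm (- h) < rho by rewrite enormN.
have low := semiconvex_mid (inb _ hr) (inb _ hr').
have up1 := touch _ hr; have := touch _ hr'; rewrite enormN dotvNr => up2.
have := le_trans (ler_norm _) (K_le h) => kh.
have : (k + C) * enorm h ^+ 2 <= eps * enorm h.
  rewrite expr2 mulrA ler_wpM2r ?enorm_ge0//.
  by rewrite mulrC -ler_pdivlMr// ltW.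
have := mulr_ge0 (ltW C_gt0) (sqr_ge0 (enorm h)).
have := mulr_ge0 (ltW k0) (sqr_ge0 (enorm h)).
move: (enorm h ^+ 2) kh up1 up2 => N kh up1 up2 kN CN kCN.
by rewrite ler_norml; apply/andP; split; lra.
Qed.

Lemma continuous_locally_lipschitz (G : 'cV[R]_n -> R) (v : 'rV[R]_n) (c d : R) :
  0 < d -> 0 < c ->
  (forall h, enorm h <= d -> `|G (v^T + h) - G v^T| <= c * enorm h) ->
  {for v, continuous (fun w : 'rV[R]_n => G w^T)}.
Proof.
move=> d0 c0 GL; apply/(@cvgrPdist_le _ _ _ _ (nbhs_filter v)) => e e0.
(* A sup-norm ball of radius [r / (n + 1)] lies in the Euclidean ball of radius [r]; the added 1
   covers [n = 0]. *)
pose N : R := n%:R + 1; have N0 : 0 < N by rewrite ltr_wpDl.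
have m0 : 0 < Num.min d (e / c) / N by rewrite divr_gt0// lt_min d0 divr_gt0.
near=> w.
have wv : enorm (w - v)^T <= Num.min d (e / c).
  have := @enorm_box (w - v)^T (Num.min d (e / c) / N) (ltW m0).
  move=> H; apply: (le_trans (H _)).
    move=> i; rewrite !mxE distrC.
    have : ball v (Num.min d (e / c) / N) w by near: w; exact: nbhsx_ballx.
    by move=> [_ /(_ 0 i)] /ltW.
  rewrite mulrCA ler_piMr ?ltW//; first by rewrite lt_min d0 divr_gt0.
  by rewrite ltr_pdivrMr// mul1r /N ltrDl.
move: wv; rewrite le_min => /andP[wd we].
have -> : w^T = v^T + (w - v)^T by rewrite -linearD/= addrC subrK.
rewrite distrC (le_trans (GL _ wd))//.
by rewrite mulrC -ler_pdivlMr.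
Unshelve. all: by end_near. Qed.

(** Maximize [f - k |. - z|^2] over a cube around [z]. In the margin, [n * rho] reaches the corners
    of the cube and [2 * rho] is the room for the Lipschitz estimate. *)
Lemma has_grad_dense z (rho : R) : 0 < rho ->
  enorm (z - x) + (n%:R + 2) * rho < r0 ->
  exists y l, enorm (y - z) <= rho /\ has_grad psi y l.
Proof.
move=> rho0 zr; have n0 : 0 <= n%:R * rho by rewrite mulr_ge0// ltW.
have zr' : enorm (z - x) + n%:R * rho + 2 * rho < r0 by lra.
(* [k * rho ^+ 2] exceeds the oscillation [2 * M] of [f], so a maximizer lies at distance less than
   [rho] from [z], inside the cube. *)
pose k := (2 * M + 1) / rho ^+ 2.
have M1 : 0 < 2 * M + 1 by move: M_gt0 => ?; lra.
have k0 : 0 < k by rewrite divr_gt0// exprn_gt0.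
pose F (y : 'cV[R]_n) := f y - k * enorm (y - z) ^+ 2.
pose D := [set v : 'rV[R]_n | forall i, (`[z i 0 - rho, z i 0 + rho]%classic : set R) (v ord0 i)].
have DP (v : 'rV[R]_n) : D v -> enorm (v^T - z) <= n%:R * rho.
  move=> Dv; apply: enorm_box; first exact: ltW.
  move=> i; rewrite !mxE; have := Dv i; rewrite /= in_itv/= => /andP[? ?].
  by rewrite ler_norml; apply/andP; split; lra.
have inb y : enorm (y - z) <= n%:R * rho -> enorm (y - x) + 2 * rho < r0.
  by move=> yz; have := enormD (y - z) (z - x); rewrite addrA subrK => ?; lra.
have Dz : D z^T by move=> i; rewrite /= in_itv/= mxE; apply/andP; split; lra.
have cD : compact D.
  apply: (@rV_compact R n (fun i => `[z i 0 - rho, z i 0 + rho]%classic : set R)) => i.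
  exact: segment_compact.
have cF : {within D, continuous (fun v : 'rV[R]_n => F v^T)}.
  apply: continuous_in_subspaceT => v; rewrite inE => Dv.
  have vr := inb _ (DP _ Dv).
  apply: (@continuous_locally_lipschitz F v ((2 * M + C * rho ^+ 2) / rho +
      k * (2 * enorm (v^T - z) + rho)) rho) => //.
    have := enorm_ge0 (v^T - z) => ?.
    have C_rho : 0 < C * rho ^+ 2 by rewrite mulr_gt0// exprn_gt0.
    by apply: addr_gt0; [rewrite divr_gt0// addr_gt0// mulr_gt0|apply: mulr_gt0 => //; lra].
  move=> h hr; have Lf := semiconvex_lipschitz rho0 vr hr.
  have -> : F (v^T + h) - F v^T = (f (v^T + h) - f v^T) -
      (2 * k) * dotv (v^T - z) h - k * enorm h ^+ 2.
    by rewrite /F (addrAC v^T h) (enormD_sqr (v^T - z) h); ring.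
  have := dotv_le (v^T - z) h; have k2 : 0 <= 2 * k by lra.
  move=> /(ler_wpM2l k2) dh.
  have hh : k * enorm h ^+ 2 <= k * (rho * enorm h).
    by rewrite ler_pM2l// expr2 ler_wpM2r ?enorm_ge0.
  have kh0 : 0 <= k * enorm h ^+ 2 by rewrite mulr_ge0 ?sqr_ge0// ltW.
  move: Lf dh; rewrite -(ger0_norm k2) -normrM (ger0_norm k2) !ler_norml.
  move=> /andP[a1 a2] /andP[b1 b2].
  by apply/andP; split; lra.
have [v vD vmax] := EVT_max_rV (ex_intro _ _ Dz) cD cF.
rewrite inE in vD; pose y := v^T; have yz := DP _ vD.
have yr := inb _ yz.
have ymax (w : 'rV[R]_n) : D w -> F w^T <= F y by move=> Dw; apply: vmax; rewrite inE.
have zx : enorm (z - x) < r0 by lra.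
have yx : enorm (y - x) < r0 by lra.
have close : enorm (y - z) < rho.
  rewrite ltNge; apply/negP => far.
  have := ymax _ Dz; rewrite /F trmxK subrr enorm0 expr0n mulr0 subr0.
  have := f_bounded zx; have := f_bounded yx; rewrite !ler_norml.
  move=> /andP[_ b1] /andP[b2 _].
  have : 2 * M + 1 <= k * enorm (y - z) ^+ 2.
    rewrite /k mulrAC ler_pdivlMr ?exprn_gt0// ler_pM2l//.
    by rewrite lerXn2r// nnegrE ?enorm_ge0// ltW.
  lra.
exists y, ((2 * k) *: (y - z)); split; first exact: ltW.
apply: (@has_grad_touching _ _ k (rho - enorm (y - z))) => //; first lra.
  by have := enorm_ge0 (y - z); lra.
move=> h hr.
have Dyh : D (y + h)^T.
  move=> i; rewrite /= in_itv/= mxE.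
  have := coord_le_enorm (y + h - z) i.
  have := enormD (y - z) h; rewrite addrAC => ? ?.
  have : `|(y + h - z) i 0| <= rho by lra.
  by rewrite !mxE ler_norml => /andP[? ?]; apply/andP; split; lra.
have := ymax _ Dyh; rewrite /F trmxK (addrAC y h) (enormD_sqr (y - z) h) dotvZl => H; lra.
Qed.

(* The differentiability points of [psi] are dense near [x]. *)
Lemma linear_vanish_at_grad (D : 'M[R]_n) :
  (forall eps : R, 0 < eps -> exists2 d : R, 0 < d & forall y gy,
     has_grad psi y gy -> enorm (y - x) < d ->
     enorm (D *m (y - x)) <= eps * enorm (y - x)) -> D = 0.
Proof.
move=> DP; have [c c0 cD] := enorm_mulmx D.
suff De (e : 'cV[R]_n) : D *m e = 0.
  apply/matrixP => i j; have := De (delta_mx j 0).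
  by move=> /matrixP/(_ i 0); rewrite -colE !mxE.
apply/enorm_eq0/eqP; rewrite eq_le enorm_ge0 andbT.
apply: (@le_of_eps _ _ (enorm e + 1 + c)).
  by have := enorm_ge0 e; lra.
move=> eps0 eps0_gt0; rewrite add0r.
pose eps := Num.min eps0 1.
have eps_gt0 : 0 < eps by rewrite lt_min eps0_gt0 ltr01.
have [epsle eps1] : eps <= eps0 /\ eps <= 1 by rewrite !ge_min !lexx orbT.
have e0 := enorm_ge0 e.
apply: (@le_trans _ _ (eps * (enorm e + 1 + c))); last by rewrite ler_wpM2r//; lra.
have [d d0 dP] := DP _ eps_gt0.
pose m := Num.min d r0; have m0 : 0 < m by rewrite lt_min d0.
(* With [s * S = m], the length [s |e|] together with the margin [(n + 2) * eps * s] demanded by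
   [has_grad_dense] fits in radius [m]. *)
pose S := enorm e + n%:R + 3; have S0 : 0 < S.
  by rewrite /S; have : 0 <= n%:R :> R by []; lra.
pose s := m / S; have s0 : 0 < s by rewrite divr_gt0.
have sS : s * S = m by rewrite /s divfK// gt_eqF.
have nn : 0 <= n%:R :> R by [].
have es : eps * s <= s by rewrite ler_piMl// ltW.
(* A differentiability point within [eps * s] of [x + s *: e] transfers the smallness of [D] to
   [s *: e]; dividing by [s] leaves [eps * (|e| + 1 + c)]. *)
have := @has_grad_dense (x + s *: e) (eps * s).
rewrite mulr_gt0// [x + _]addrC addrK enormZ gtr0_norm//.
case=> //.
  have : m <= r0 by rewrite ge_min lexx orbT.
  by rewrite -sS /S; nra.
move=> y [l [yz yl]].
have yx : enorm (y - x) <= s * enorm e + eps * s.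
  have -> : y - x = (y - (s *: e + x)) + s *: e.
    by rewrite opprD addrA [RHS]addrAC subrK.
  by rewrite (le_trans (enormD _ _))// enormZ gtr0_norm//; lra.
have yd : enorm (y - x) < d.
  have : m <= d by rewrite ge_min lexx.
  by rewrite -sS /S; nra.
have h1 := dP _ _ yl yd; have h2 := cD (y - (s *: e + x)).
have := enormB (D *m (y - x)) (D *m (y - (s *: e + x))).
rewrite -mulmxBr opprB addrC addrA subrK addrK -scalemxAr enormZ gtr0_norm// => h3.
rewrite -(ler_pM2l s0).
have : c * enorm (y - (s *: e + x)) <= c * (eps * s) by rewrite ler_pM2l.
have : eps * enorm (y - x) <= eps * (s * enorm e + s) by rewrite ler_pM2l//; lra.
lra.
Qed.

End SemiconvexDifferentiability.

Lemma continuous_det (R : realType) k (F dF : R -> 'M[R]_k) :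
  (forall t, mderiv F t (dF t)) -> continuous (fun t => \det (F t)).
Proof.
move=> FD t; apply/differentiable_continuous/derivable1_diffP.
by apply: derivable_det => i j; have [] := FD t i j.
Qed.

(** * The determinant inequality from the algebraic relations between [S3], [S4], [K] and [P] *)

Section DistortionAlongInterpolation.
Variables (R : realType) (n : nat) (T : R) (P : 'M[R]_n).
Variables S3 S4 K : R -> 'M[R]_n.
Hypotheses (n_gt0 : (0 < n)%N) (T_gt0 : 0 < T) (Psym : P^T = P).
Hypotheses (S3_0 : S3 0 = 0) (S4_0 : S4 0 = 1%:M).
Hypothesis S3_opp : forall t, S3 (- t) = - (S3 t)^T.
Hypothesis S3_neq0 : forall t, 0 < t <= T -> \det (S3 t) != 0.
Hypothesis S3K : forall t, 0 < t <= T -> S3 t *m K t = S4 t.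
Hypothesis K_sym : forall t, 0 < t <= T -> (K t)^T = K t.
Hypothesis K_diff : forall s t, 0 < s <= T -> 0 < t <= T ->
  K s - K t = invmx (S3 s) *m S3 (s - t) *m invmx (S3 (- t)).
Hypothesis K_nincr : forall s t, 0 < s -> s < t -> t <= T ->
  forall v, dotv v (K t *m v) <= dotv v (K s *m v).
Local Notation L t := (S3 t *m P + S4 t).
Hypothesis det_S3_continuous : continuous (fun t => \det (S3 t)).
Hypothesis det_L_continuous : continuous (fun t => \det (L t)).
Hypothesis hessian_ge : forall v, 0 <= dotv v ((P + K T) *m v).

Lemma continuous_pos (phi : R -> R) a b : a <= b -> continuous phi ->
  (forall t, a <= t <= b -> phi t != 0) -> 0 < phi a -> 0 < phi b.
Proof.
move=> ab cphi nz pa; rewrite ltNge; apply/negP => pb.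
have [||c] := @IVT R phi a b 0 ab; first exact: continuous_subspaceT.
  by rewrite ge_min le_max (ltW pa) pb orbT.
by rewrite in_itv/= => cab /eqP; apply/negP; exact: nz.
Qed.

Lemma psd_riccati_diff s t : 0 < s -> s < t -> t <= T -> psd (K s - K t).
Proof.
move=> s0 st tT; split; first by rewrite linearB/= !K_sym//; lra.
by move=> v; rewrite mulmxBl dotvDr dotvNr subr_ge0; exact: K_nincr.
Qed.

Lemma det_S3_opp t : \det (S3 (- t)) = (-1) ^+ n * \det (S3 t).
Proof. by rewrite S3_opp -scaleN1r detZ det_tr. Qed.

Lemma det_riccati_diff s t : 0 < s -> s < t -> t <= T ->
  \det (K s - K t) = (\det (S3 s))^-1 * \det (S3 (s - t)) * (\det (S3 (- t)))^-1.
Proof. by move=> s0 st tT; rewrite K_diff; [rewrite !det_mulmx !det_inv|lra|lra]. Qed.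

(** In the factorization [K_diff] all times are, up to sign, in [(0, T]], where [det S3] does not
    vanish. *)
Lemma det_riccati_diff_neq0 s t : 0 < s -> s < t -> t <= T ->
  \det (K s - K t) != 0.
Proof.
move=> s0 st tT; rewrite det_riccati_diff// -[s - t]opprB !det_S3_opp.
by rewrite !(mulf_neq0, invr_neq0) ?signr_eq0 ?S3_neq0//; lra.
Qed.

Lemma psd_hessian_riccati t : 0 < t <= T -> psd (P + K t).
Proof.
have pT : psd (P + K T).
  by split; [rewrite linearD/= Psym K_sym// T_gt0 lexx|].
move=> /andP[t0]; rewrite le_eqVlt => /predU1P[->//|tT].
rewrite (_ : P + K t = (P + K T) + (K t - K T)); last by rewrite addrACA subrr addr0.
by apply: psdD => //; exact: psd_riccati_diff.
Qed.

Lemma minkowski_riccati s t : 0 < s -> s < t -> t <= T ->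
  rootn n (\det (K s - K t)) + rootn n (\det (P + K t)) <= rootn n (\det (P + K s)).
Proof.
move=> s0 st tT; have t0 := lt_trans s0 st.
have -> : P + K s = (K s - K t) + (P + K t) by rewrite addrACA addNr addr0 addrC.
apply: minkowski_det => //; first exact: psd_riccati_diff.
  by apply: psd_hessian_riccati; rewrite t0.
exact: det_riccati_diff_neq0.
Qed.

(** Minkowski with the definite summand [K t - K T] gives strictness even if [P + K T] is
    singular. *)
Lemma det_hessian_riccati_gt0 t : 0 < t < T -> 0 < \det (P + K t).
Proof.
move=> /andP[t0 tT]; have := minkowski_riccati t0 tT (lexx T).
have /andP[dP _] : 0 <= \det (P + K t) <= \prod_i (P + K t) i i.
  by apply/hadamard_psd/psd_hessian_riccati; rewrite t0 ltW.
have /andP[dM _] : 0 <= \det (P + K T) <= \prod_i (P + K T) i i.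
  by apply/hadamard_psd/psd_hessian_riccati; rewrite T_gt0/=.
have /andP[dN _] := hadamard_psd (psd_riccati_diff t0 tT (lexx T)).
have : 0 < rootn n (\det (K t - K T)).
  by apply: rootn_gt0; rewrite lt_neqAle dN eq_sym det_riccati_diff_neq0.
move=> N0; have M0 := rootn_ge0 n dM; rewrite lt_neqAle dP andbT eq_sym => le.
have : 0 < rootn n (\det (P + K t)) by exact: lt_le_trans (ltr_wpDr M0 N0) le.
by apply: contraTneq => ->; rewrite rootn0 ltxx.
Qed.

Lemma det_transport t : 0 < t <= T -> \det (L t) = \det (S3 t) * \det (P + K t).
Proof. by move=> tT; rewrite -det_mulmx mulmxDr S3K. Qed.

Lemma transport0 : L 0 = 1%:M.
Proof. by rewrite S3_0 S4_0 mul0mx add0r. Qed.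

(** The sign of [det S3] is still unknown here: only nonvanishing is used, and positivity is carried
    by continuity from [L 0 = 1]. *)
Lemma det_transport_gt0 t : 0 <= t < T -> 0 < \det (L t).
Proof.
move=> /andP[t0 tT].
apply: (@continuous_pos (fun t => \det (L t)) 0 t) => //.
- move=> s /andP[]; rewrite le_eqVlt => /predU1P[<-|s0] st.
    by rewrite transport0 det1 oner_eq0.
  have sT : s < T := le_lt_trans st tT.
  rewrite det_transport ?s0 ?ltW// mulf_neq0 ?S3_neq0 ?s0 ?ltW//.
  by rewrite gt_eqF// det_hessian_riccati_gt0// s0.
- by rewrite transport0 det1.
Qed.

(** Before [T] both other determinants in [det_transport] are positive; at [T] the sign is inherited
    by continuity from [T / 2]. *)
Lemma det_S3_gt0 t : 0 < t <= T -> 0 < \det (S3 t).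
Proof.
have lt_case s : 0 < s < T -> 0 < \det (S3 s).
  move=> /[dup] sT /andP[s0 sT']; have := @det_transport_gt0 s.
  rewrite (ltW s0) sT' det_transport ?s0 ?ltW// => /(_ isT).
  by rewrite pmulr_lgt0// det_hessian_riccati_gt0.
move=> /[dup] tT /andP[t0]; rewrite le_eqVlt => /predU1P[tE|tlT]; last first.
  by apply: lt_case; rewrite t0.
apply: (@continuous_pos (fun t => \det (S3 t)) (t / 2) t) => //; first by lra.
- by move=> s /andP[ts st]; apply: S3_neq0; lra.
- by apply: lt_case; lra.
Qed.

(** Cancels the sign [(-1) ^+ n] produced by [S3 (- t) = - (S3 t)^T], for either parity of [n]. *)
Lemma rootn_sign_ratio (a b : R) :
  rootn n ((-1) ^+ n * a) / rootn n ((-1) ^+ n * b) = rootn n a / rootn n b.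
Proof.
have : rootn n ((-1) ^+ n : R) != 0.
  have : rootn n ((-1) ^+ n : R) * rootn n ((-1) ^+ n)^-1 = 1.
    by rewrite -rootnM divff ?rootn1// signr_eq0.
  by apply: contra_eqN => /eqP ->; rewrite mul0r eq_sym oner_eq0.
by rewrite !rootnM -mulf_div => /divff ->; rewrite mul1r.
Qed.

Lemma det_S3_0 : \det (S3 0) = 0.
Proof.
rewrite S3_0; have : (0 < n)%N by []; move: (n) => [//|k] _; exact: det0.
Qed.

Lemma rootn_S3_ratio s t :
  rootn n (\det (S3 (- s))) / rootn n (\det (S3 (- t))) =
  rootn n (\det (S3 s)) / rootn n (\det (S3 t)).
Proof.
by rewrite !det_S3_opp rootn_sign_ratio.
Qed.

Lemma rootn_det_S3_gt0 t : 0 < t <= T -> 0 < rootn n (\det (S3 t)).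
Proof. by move=> ?; apply/rootn_gt0/det_S3_gt0. Qed.

Lemma rootn_det_S3_ge0 t : 0 <= t <= T -> 0 <= rootn n (\det (S3 t)).
Proof.
move=> /andP[]; rewrite le_eqVlt => /predU1P[<- _|t0 tT].
  by rewrite det_S3_0 rootn0.
by rewrite ltW// rootn_det_S3_gt0// t0.
Qed.

Lemma first_term_ge0 s t : 0 < s <= T -> 0 <= t <= s ->
  0 <= rootn n (\det (S3 (t - s))) / rootn n (\det (S3 (- s))).
Proof.
move=> sT ts; rewrite -[t - s]opprB rootn_S3_ratio divr_ge0 ?rootn_det_S3_ge0//; lra.
Qed.

Lemma first_term_gt0 s t : 0 < s <= T -> 0 <= t < s ->
  0 < rootn n (\det (S3 (t - s))) / rootn n (\det (S3 (- s))).
Proof.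
move=> sT ts; rewrite -[t - s]opprB rootn_S3_ratio divr_gt0 ?rootn_det_S3_gt0//; lra.
Qed.

Lemma det_transport_ge0 t : 0 < t <= T -> 0 <= \det (L t).
Proof.
move=> tT; rewrite det_transport//; apply: mulr_ge0; first exact/ltW/det_S3_gt0.
by have /andP[] := hadamard_psd (psd_hessian_riccati tT).
Qed.

Lemma second_term_ge0 s t : 0 < s <= T -> 0 <= t <= s ->
  0 <= rootn n (\det (S3 t)) / rootn n (\det (S3 s)) * rootn n (\det (L s)).
Proof.
move=> sT ts; rewrite mulr_ge0 ?divr_ge0 ?rootn_det_S3_ge0//; try lra.
by apply/rootn_ge0/det_transport_ge0.
Qed.

Lemma det_transport_concave s t : 0 < s <= T -> 0 <= t <= s ->
  rootn n (\det (S3 (t - s))) / rootn n (\det (S3 (- s)))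
  + rootn n (\det (S3 t)) / rootn n (\det (S3 s)) * rootn n (\det (L s))
  <= rootn n (\det (L t)).
Proof.
move=> sT /andP[]; have rs := rootn_det_S3_gt0 sT.
rewrite le_eqVlt => /predU1P[<- _|t0].
  (* At [t = 0] the terms are 1, 0 and 1, so equality holds. *)
  rewrite sub0r rootn_S3_ratio divff ?gt_eqF//.
  by rewrite det_S3_0 rootn0 !mul0r addr0 transport0 det1 rootn1.
rewrite le_eqVlt => /predU1P[->|ts].
  by rewrite subrr det_S3_0 rootn0 mul0r add0r divff ?mul1r// gt_eqF.
have tT : 0 < t <= T by case/andP: sT => _ sT; rewrite t0 (le_trans (ltW ts)).
have rt := rootn_det_S3_gt0 tT; case/andP: sT (sT) => s0 sT sT'.
(* Minkowski for [P + K t = (K t - K s) + (P + K s)], multiplied by the root of [det (S3 t)]. *)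
have := minkowski_riccati t0 ts sT.
rewrite det_riccati_diff// !det_transport// !rootnM !rootnV -(ler_pM2l rt).
apply: le_trans; rewrite mulrDr lerD//.
  by rewrite !mulrA divff ?mul1r// gt_eqF.
by rewrite mulrA divfK// gt_eqF.
Qed.

Lemma transport_distortion :
  (forall s t, 0 < s <= T -> 0 <= t <= s ->
     rootn n (\det (S3 (t - s))) / rootn n (\det (S3 (- s)))
     + rootn n (\det (S3 t)) / rootn n (\det (S3 s)) * rootn n (\det (L s))
     <= rootn n (\det (L t))) /\
  (forall s t, 0 < s <= T -> 0 <= t <= s ->
     0 <= rootn n (\det (S3 (t - s))) / rootn n (\det (S3 (- s))) /\
     0 <= rootn n (\det (S3 t)) / rootn n (\det (S3 s)) * rootn n (\det (L s))) /\
  (forall s t, 0 < s <= T -> 0 <= t < s ->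
     0 < rootn n (\det (S3 (t - s))) / rootn n (\det (S3 (- s)))) /\
  (forall t, 0 <= t < T -> 0 < \det (L t)).
Proof.
split; first exact: det_transport_concave.
split; first by move=> s t sT ts; split; [exact: first_term_ge0|exact: second_term_ge0].
by split; [exact: first_term_gt0|exact: det_transport_gt0].
Qed.

End DistortionAlongInterpolation.

(** * Existence and uniqueness of the differential of the transport map *)

Section TransportDifferential.
Variables (R : realType) (n m : nat).
Variables (A : 'M[R]_n) (B : 'M[R]_(n, m)) (Q : 'M[R]_n).
Variables (psi : 'cV[R]_n -> \bar R) (x g : 'cV[R]_n) (P : 'M[R]_n).
Hypothesis psi_g : has_grad psi x g.
Hypothesis grad_diff : forall eps : R, 0 < eps -> exists2 d : R, 0 < d &
  forall y gy, has_grad psi y gy -> enorm (y - x) < d ->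
  enorm (gy - g - P *m (y - x)) <= eps * enorm (y - x).
Hypothesis vanish : forall D : 'M[R]_n,
  (forall eps : R, 0 < eps -> exists2 d : R, 0 < d & forall y gy,
     has_grad psi y gy -> enorm (y - x) < d ->
     enorm (D *m (y - x)) <= eps * enorm (y - x)) -> D = 0.

Lemma transport_diff_hessian tau :
  transport_diff_at A B Q psi tau x (R3 A B Q tau *m P + R4 A B Q tau).
Proof.
move=> gx /(has_grad_unique psi_g) <- eps eps0.
have [c c0 cR] := enorm_mulmx (R3 A B Q tau).
have [d d0 D] := grad_diff (divr_gt0 eps0 c0); exists d => // y gy gyP yx.
have -> : lq_exp A B Q y tau gy - lq_exp A B Q x tau g
    - (R3 A B Q tau *m P + R4 A B Q tau) *m (y - x) =
    R3 A B Q tau *m (gy - g - P *m (y - x)).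
  rewrite /lq_exp; move: (R3 A B Q tau) (R4 A B Q tau) => S W.
  rewrite !(mulmxDl, mulmxDr, mulmxN, mulNmx) !mulmxA.
  move: (S *m gy) (S *m g) (W *m y) (W *m x) (S *m P *m y) (S *m P *m x).
  by move=> *; apply/matrixP => i j; rewrite !mxE; ring.
rewrite (le_trans (cR _))// mulrC -ler_pdivlMr//.
by rewrite (le_trans (D _ _ gyP yx))// mulrAC.
Qed.

Lemma transport_diff_unique tau L1 L2 :
  transport_diff_at A B Q psi tau x L1 -> transport_diff_at A B Q psi tau x L2 ->
  L1 = L2.
Proof.
move=> h1 h2; apply/eqP; rewrite -subr_eq0; apply/eqP/vanish => eps eps0.
have e2 : 0 < eps / 2 by rewrite divr_gt0.
have [d1 d1_0 D1] := h1 _ psi_g _ e2; have [d2 d2_0 D2] := h2 _ psi_g _ e2.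
exists (Num.min d1 d2); first by rewrite lt_min d1_0.
move=> y gy gyP; rewrite lt_min => /andP[y1 y2].
have := D1 _ _ gyP y1; have := D2 _ _ gyP y2.
move: (lq_exp A B Q y tau gy - _) => e a b.
have -> : (L1 - L2) *m (y - x) = (e - L2 *m (y - x)) - (e - L1 *m (y - x)).
  by rewrite mulmxBl opprB [RHS]addrC addrA subrK.
by rewrite (le_trans (enormB _ _))//; lra.
Qed.

End TransportDifferential.

Unset Implicit Arguments.

Theorem theorem5p2 (R : realType) (n m : nat)
  (A : 'M[R]_n) (B : 'M[R]_(n, m)) (Q : 'M[R]_n) (T : R)
  (mu nu : probability (Rn R n) R) (psi : 'cV[R]_n -> \bar R)
  (x : 'cV[R]_n) :
  (0 < n)%N -> (m <= n)%N -> \rank B = m -> Q^T = Q ->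
  kalman A B -> 0 < T -> (T%:E < first_conj_time A B Q)%E ->
  finite_second_moment mu -> finite_second_moment nu -> abs_cont_leb mu ->
  kantorovich_potential (lq_cost A B Q T) mu nu psi ->
  twice_diff psi x ->
  (forall tau, 0 <= tau <= T ->
     exists L : 'M[R]_n, transport_diff_at A B Q psi tau x L) /\
  (forall L : R -> 'M[R]_n,
     (forall tau, 0 <= tau <= T -> transport_diff_at A B Q psi tau x (L tau)) ->
     (forall s tau, 0 < s <= T -> 0 <= tau <= s ->
        rootn n (\det (R3 A B Q (tau - s))) / rootn n (\det (R3 A B Q (- s)))
        + rootn n (\det (R3 A B Q tau)) / rootn n (\det (R3 A B Q s))
          * rootn n (\det (L s))
        <= rootn n (\det (L tau))) /\
     (forall s tau, 0 < s <= T -> 0 <= tau <= s ->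
        0 <= rootn n (\det (R3 A B Q (tau - s))) / rootn n (\det (R3 A B Q (- s)))
        /\ 0 <= rootn n (\det (R3 A B Q tau)) / rootn n (\det (R3 A B Q s))
               * rootn n (\det (L s))) /\
     (forall s tau, 0 < s <= T -> 0 <= tau < s ->
        0 < rootn n (\det (R3 A B Q (tau - s))) / rootn n (\det (R3 A B Q (- s)))) /\
     (forall tau, 0 <= tau < T -> 0 < \det (L tau))).
Proof.
move=> n0 _ _ Qsym _ T0 Tconj _ _ _ [cpsi _] [g [P [psi_g [Psym taylor]]]].
(* A zero of [det R3] at some [t <= T] would belong to the set whose infimum is the first conjugate
   time. *)
have R3nz t : 0 < t <= T -> \det (R3 A B Q t) != 0.
  move=> /andP[t0 tT]; apply/eqP => dt; move: Tconj; apply/negP; rewrite -leNgt.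
  apply: (@le_trans _ _ t%:E); last by rewrite lee_fin.
  by apply: ereal_inf_lbound; exists t.
have R3T : \det (R3 A B Q T) != 0 by apply: R3nz; rewrite T0 lexx.
set K := riccati A B Q T.
(* The expansion with [eps = 1] fixes a ball where [psi] is finite; the cap of the radius at 1 makes
   [M] below a bound for [psi] on it. *)
have [d1 d1_0 D1] := taylor 1 ltr01.
pose r0 := Num.min d1 1; have r0_gt0 : 0 < r0 by rewrite lt_min d1_0 ltr01.
have near (y : 'cV[R]_n) : enorm (y - x) < r0 -> enorm (y - x) < d1 /\ enorm (y - x) < 1.
  by rewrite lt_min => /andP[].
have yE (y : 'cV[R]_n) : y = x + (y - x) by rewrite addrC subrK.
have psi_fin (y : 'cV[R]_n) : enorm (y - x) < r0 -> psi y \is a fin_num.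
  by move=> /near[yd _]; have [+ _] := D1 _ yd; rewrite -yE.
have semiconvex (t : R) (y h : 'cV[R]_n) : 0 <= t <= 1 ->
    enorm (y - x) < r0 -> enorm (y + h - x) < r0 ->
    fine (psi (y + t *: h)) <= (1 - t) * fine (psi y) + t * fine (psi (y + h))
      + t * (1 - t) * (2^-1 * dotv h (K *m h)).
  move=> t01 yr yhr; move/andP: (t01) => [t0 t1].
  have yth : enorm (y + t *: h - x) < r0.
    have -> : y + t *: h - x = (1 - t) *: (y - x) + t *: (y + h - x).
      by apply/matrixP => i j; rewrite !mxE; ring.
    have t1' : 0 <= 1 - t by rewrite subr_ge0.
    rewrite (le_lt_trans (enormD _ _))// !enormZ !ger0_norm//.
    have [->|t_neq0] := eqVneq t 0; first by rewrite subr0 mul1r mul0r addr0.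
    have tp : 0 < t by rewrite lt_neqAle eq_sym t_neq0.
    have := ler_wpM2l t1' (ltW yr).
    have : t * enorm (y + h - x) < t * r0 by rewrite ltr_pM2l.
    by lra.
  (* Applied at the intermediate point [y + t *: h], whose two companions are exactly [y] and
     [y + h]. *)
  have := @c_convex_semiconvex R n m A B Q T T0 R3T psi t (y + t *: h) h
    (fine (psi y)) (fine (psi (y + h))) cpsi t01.
  rewrite addrK (_ : y + t *: h + (1 - t) *: h = y + h); last first.
    by rewrite -addrA -scalerDl addrCA subrr addr0 scale1r.
  rewrite !fineK ?psi_fin//.
  by move=> /(_ erefl erefl) H; rewrite -lee_fin fineK ?psi_fin.
have tay eps : 0 < eps -> exists2 d : R, 0 < d & forall v : 'cV[R]_n, enorm v < d ->
    `|fine (psi (x + v)) - fine (psi x) - dotv g v - 2^-1 * dotv (P *m v) v|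
    <= eps * enorm v ^+ 2.
  by move=> /taylor[d d0 D]; exists d => // v vd; have [] := D _ vd.
have hess := hessian_semiconvex r0_gt0 semiconvex tay.
have [C C0 CK] := quad_form_bound K; have [c c0 cP] := quad_form_bound P.
pose M := `|fine (psi x)| + enorm g + c + 1.
have M0 : 0 < M by rewrite /M ltr_wpDl// !addr_ge0 ?enorm_ge0// ltW.
have bounded (y : 'cV[R]_n) : enorm (y - x) < r0 -> `|fine (psi y)| <= M.
  move=> /near[yd y1]; have [_] := D1 _ yd; rewrite -yE mul1r.
  have := dotv_le g (y - x); have := cP (y - x); rewrite dotvC.
  have := enorm_ge0 (y - x); set N := enorm (y - x) in y1 * => N0.
  have NN : N ^+ 2 <= 1 by rewrite expr_le1// ltW.
  have gN : enorm g * N <= enorm g by rewrite ler_piMr ?enorm_ge0// ltW.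
  have cN : c * N ^+ 2 <= c by rewrite ler_piMr// ltW.
  move=> h1 h2 h3; rewrite /M.
  have := ler_norm (fine (psi x)); have := ler_norm (- fine (psi x)); rewrite normrN.
  move: h1 h2 h3; rewrite !ler_norml => /andP[? ?] /andP[? ?] /andP[? ?] ? ?.
  by apply/andP; split; lra.
have gradD eps : 0 < eps -> exists2 d : R, 0 < d &
    forall y gy, has_grad psi y gy -> enorm (y - x) < d ->
    enorm (gy - g - P *m (y - x)) <= eps * enorm (y - x).
  move=> eps0; have [d d0 D] := grad_differentiable Psym r0_gt0 semiconvex tay eps0.
  by exists d => // y gy gyP; exact: D.
have vanish := linear_vanish_at_grad r0_gt0 psi_fin semiconvex C0 M0 CK bounded.
have diffL := transport_diff_hessian A B Q psi_g gradD.
split=> [tau _|L LP]; first by exists (R3 A B Q tau *m P + R4 A B Q tau); exact: diffL.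
have mderivL (t : R) : mderiv (fun t => R3 A B Q t *m P + R4 A B Q t) t _ :=
  mderivD (mderivMr P (mderiv_R3 A B Q t)) (mderiv_R4 A B Q t).
have Knincr s t : 0 < s -> s < t -> t <= T -> forall v : 'cV[R]_n,
    dotv v (riccati A B Q t *m v) <= dotv v (riccati A B Q s *m v).
  move=> s0 st tT; apply: (riccati_nincr Qsym s0 st) => u /andP[su ut].
  by apply: R3nz; rewrite (lt_le_trans s0)// (le_trans ut).
have LE tau : 0 <= tau <= T -> L tau = R3 A B Q tau *m P + R4 A B Q tau.
  by move=> tT; exact: (transport_diff_unique psi_g vanish (LP _ tT) (diffL tau)).
have [h1 [h2 [h3 h4]]] : _ := transport_distortion n0 T0 Psym (R3_0 A B Q) (R4_0 A B Q)
  (R3_opp A B Qsym) R3nz (fun t tT => R3_riccati (R3nz t tT))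
  (fun t tT => riccati_sym Qsym (R3nz t tT))
  (fun s t sT tT => riccati_diff Qsym (R3nz t tT) (R3nz s sT))
  Knincr (continuous_det (mderiv_R3 A B Q)) (continuous_det mderivL) hess.
split=> [s tau sT ts|]; first by rewrite !LE; [exact: h1|lra|lra].
split=> [s tau sT ts|]; first by rewrite !LE; [exact: h2|lra].
by split=> [s tau sT ts|tau tT]; [exact: h3|rewrite LE; [exact: h4|lra]].
Qed.
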